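(* Let $\mu$ be a positive Borel measure on $\mathbb T$, singular with respect to $m$, with $\mu(\mathbb T)=1$; let $U_\mu$ be multiplication by the independent variable on $L^2(\mu)$; let $\theta$ and $J_{\theta,1}^{-1}\in\mathcal L(L^2(\mu),\mathcal K_\theta)$ be associated with $\mu$ as described in the context. Let $\omega\in H^\infty$ be inner, $g\in H^2$, and suppose $X\in\mathcal L(\mathcal K_\theta,\mathcal K_\omega)$ acts by $Xf=gf$, $f\in\mathcal K_\theta$, and $X\mathcal K_\theta$ is dense in $\mathcal K_\omega$. Let $T\in\mathcal L(\mathcal K_\omega)$ be invertible with $XJ_{\theta,1}^{-1}U_\mu=TXJ_{\theta,1}^{-1}$. Then $$\sup_{n\geq0}\|T^{-n}\|\leq\Bigl(\sup_{n\geq0}\|T^n\|\Bigr)^5 .$$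
   Context: $m$ is normalized Lebesgue measure on the unit circle $\mathbb T$; $H^2$ is the Hardy space of the unit disk $\mathbb D$, identified with a subspace of $L^2(m)$; for inner $\theta$, $\mathcal K_\theta=H^2\ominus\theta H^2$. Given a positive singular Borel measure $\mu$ on $\mathbb T$ with $\mu(\mathbb T)=1$, $\theta$ is the function on $\mathbb D$ defined by $\frac{1}{1-\theta(z)}=\int_{\mathbb T}\frac{d\mu(\zeta)}{1-z\overline\zeta}$; it is inner with $\theta(0)=0$, and the operator $J_{\theta,1}^{-1}$ defined by $(J_{\theta,1}^{-1}\gamma)(z)=(1-\theta(z))\int_{\mathbb T}\frac{\gamma(\zeta)}{1-z\overline\zeta}d\mu(\zeta)$, $z\in\mathbb D$, $\gamma\in L^2(\mu)$, is a unitary operator from $L^2(\mu)$ onto $\mathcal K_\theta$ (Clark). *)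

(* Defs.v *)
From mathcomp Require Import all_boot all_order all_algebra.
From mathcomp Require Import all_classical all_reals all_analysis.
From mathcomp Require Import complex.
Set Implicit Arguments.
Unset Strict Implicit.
Unset Printing Implicit Defensive.
Import Order.TTheory GRing.Theory Num.Theory.
Import numFieldNormedType.Exports.
Local Open Scope classical_set_scope.
Local Open Scope ring_scope.

Section HardyModel.
Variable R : realType.
Local Notation C := (R[i]).

Definition sqn (z : C) : R := complex.Re z ^+ 2 + complex.Im z ^+ 2.

Definition cseries_to (u : nat -> C) (l : C) : Prop :=
  (fun N : nat => complex.Re (\sum_(n < N) u n)) @ \oo --> (complex.Re l : R) /\
  (fun N : nat => complex.Im (\sum_(n < N) u n)) @ \oo --> (complex.Im l : R).

Definition disk := {z : C | `|z| < 1}.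

Definition ext (f : disk -> C) : C -> C := fun z => oapp f 0 (insub z).

(* a is the Taylor coefficient sequence of f on D, i.e. f z = sum a_n z^n on D;
   (such f are exactly the holomorphic functions on D) *)
Definition is_taylor (a : nat -> C) (f : disk -> C) : Prop :=
  forall z : disk, cseries_to (fun n => a n * (val z) ^+ n) (f z).

Definition H2 (f : disk -> C) : Prop :=
  exists a, is_taylor a f /\
    exists l : R, (fun N : nat => \sum_(n < N) sqn (a n)) @ \oo --> l.

(* H^2 norm ( = (sum |a_n|^2)^(1/2) = L^2(m)-norm of the boundary function ) *)
Definition h2norm (f : disk -> C) : R :=
  Num.sqrt (fine (ereal_sup [set x : \bar R | exists a N,
     is_taylor a f /\ x = (\sum_(n < N) sqn (a n))%:E])).

Definition h2orth (f h : disk -> C) : Prop :=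
  exists a b, is_taylor a f /\ is_taylor b h /\
    cseries_to (fun n => a n * conjc (b n)) 0.

Definition Hinf (f : disk -> C) : Prop :=
  (exists a, is_taylor a f) /\ exists M : R, forall z, `|f z| <= Complex M 0.

(* the point e^{it} of the unit circle T; T is parametrized by t in [0, 2 pi) *)
Definition expi (t : R) : C := Complex (cos t) (sin t).

Definition Tpar : set R := `[0, 2 * pi[%classic.

Definition inner (th : disk -> C) : Prop :=
  Hinf th /\
  {ae (@lebesgue_measure R), forall t, Tpar t ->
     exists l : C, `|l| = 1 /\
       (fun r : R => complex.Re (ext th (Complex r 0 * expi t))) @ at_left 1
          --> (complex.Re l : R) /\
       (fun r : R => complex.Im (ext th (Complex r 0 * expi t))) @ at_left 1
          --> (complex.Im l : R)}.

Definition Kmod (th : disk -> C) (f : disk -> C) : Prop :=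
  H2 f /\ forall h, H2 h -> h2orth f (fun z => th z * h z).

Definition Cint (mu : {measure set R -> \bar R}) (f : R -> C) : C :=
  Complex (Rintegral mu setT (fun t => complex.Re (f t)))
          (Rintegral mu setT (fun t => complex.Im (f t))).

Definition L2mu (mu : {measure set R -> \bar R}) (gam : R -> C) : Prop :=
  measurable_fun setT (fun t => complex.Re (gam t)) /\
  measurable_fun setT (fun t => complex.Im (gam t)) /\
  (\int[mu]_t (sqn (gam t))%:E < +oo)%E.

Definition Umu (gam : R -> C) : R -> C := fun t => expi t * gam t.

(* the inner function theta:  1/(1 - theta z) = int dmu(zeta)/(1 - z conj zeta) *)
Definition clark_theta (mu : {measure set R -> \bar R}) : disk -> C :=
  fun z => 1 - (Cint mu (fun t => (1 - val z * conjc (expi t))^-1))^-1.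

Definition clarkJinv (mu : {measure set R -> \bar R}) (gam : R -> C)
  : disk -> C :=
  fun z => (1 - clark_theta mu z) *
           Cint mu (fun t => gam t / (1 - val z * conjc (expi t))).

Definition bdd_op (om : disk -> C) (A : (disk -> C) -> (disk -> C)) : Prop :=
  (forall f, Kmod om f -> Kmod om (A f)) /\
  (forall (c : C) f h, Kmod om f -> Kmod om h ->
      A (fun z => c * f z + h z) = (fun z => c * A f z + A h z)) /\
  (exists M : R, forall f, Kmod om f -> h2norm (A f) <= M * h2norm f).

Definition opnorm (om : disk -> C) (A : (disk -> C) -> (disk -> C)) : \bar R :=
  ereal_sup [set (h2norm (A f))%:E | f in [set f | Kmod om f /\ h2norm f <= 1]].

End HardyModel.

(* Main.v *)
(** Write [Z] for the independent variable on the circle and [J p] for the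
    image of [p] in [K_theta] under the inverse Clark transform.  Since
    [theta] is inner, [|J p| = |J (conj (Z p))|] almost everywhere on the
    circle, hence [||g J p|| = ||g J (conj (Z p))||].  For a polynomial [p]
    this gives [||T^-n g J p|| = ||g J (Z^-n p)|| = ||g J (Z^n conj (Z p))||
    = ||T^n g J (conj (Z p))|| <= C ||g J p||] with [C = sup ||T^n||].  The
    functions [g J p] are dense in [K_omega], so [sup ||T^-n|| <= C]; and
    [C <= C^5], because [C >= 1] unless [K_omega = 0].

    No boundary values are used: functions are replaced by their Taylor
    coefficients, on the circle [conj A] becomes the reversed conjugate of the
    polynomial [A], and "theta is inner" becomes orthonormality of the shifts
    of its coefficient sequence.  The latter follows from
    [1 - |theta|^2 <= min (1, 4 P[mu])], where the means over roots of unity of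
    the Poisson integral [P[mu]] are small off a neighbourhood of small length
    carrying almost all of the singular measure [mu]. *)

Require Import Defs.
From mathcomp Require Import all_boot all_order all_algebra.
From mathcomp Require Import all_classical all_reals all_analysis.
From mathcomp Require Import measurable_realfun.
From mathcomp Require Import complex ring lra zify.
Set Implicit Arguments.
Unset Strict Implicit.
Unset Printing Implicit Defensive.
Import Order.TTheory GRing.Theory Num.Theory.
Import numFieldNormedType.Exports.
Local Open Scope classical_set_scope.
Local Open Scope ring_scope.

(** * Complex numbers and limits *)

Section ComplexModulus.
Variable R : realType.
Local Notation C := (R[i]).
Implicit Types x y z : C.

(** For [p = Z^-n q], with [q] a polynomial of degree below [L], the Cauchy transform of [p] is
    explicit and [z^n J p = A - theta B] with polynomials [A], [B] of degree below [L]. Passing from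
    [p] to [conj (Z p)] swaps the pair: on the circle the new polynomials are [- z^(L-1) conj B] and
    [- z^(L-1) conj A]. If multiplication by [theta] is isometric, then [||g (A - theta B)||^2 = ||g
    A||^2 + ||g B||^2 - 2 Re <g A, theta g B>], and the swap leaves the right side unchanged. This
    replaces the almost everywhere equality of moduli. The obstacle is the isometry. The bound
    [||theta|| <= 1] costs little: [1 - sum |theta_k|^2] over a finite range is the integral of a
    square against [mu]. Singularity of [mu] is needed for the reverse direction, proved in the form
    [||theta (1 + c z^k)||^2 >= 2] for [|c| = 1] and [k > 0]. Since the left side is at most
    [2 + 2 Re (c <z^k theta, theta>)], the choices [c = 1, -1, i, -i] give orthogonality, and then
    the norm is 1. *)

Definition cm : C -> R := @Normc.normc R.

Lemma cm_norm z : `|z| = Complex (cm z) 0. Proof. by []. Qed.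

Lemma sqn_ge0 z : 0 <= sqn z.
Proof. by rewrite /sqn addr_ge0 ?sqr_ge0. Qed.

Lemma cmE z : cm z = Num.sqrt (sqn z). Proof. by case: z. Qed.

Lemma cm_ge0 z : 0 <= cm z. Proof. by rewrite cmE sqrtr_ge0. Qed.

Lemma cm_sqr z : cm z ^+ 2 = sqn z.
Proof. by rewrite cmE sqr_sqrtr ?sqn_ge0. Qed.

Lemma cmD x y : cm (x + y) <= cm x + cm y.
Proof. exact: le_normcD. Qed.

Lemma cmN x : cm (- x) = cm x. Proof. exact: normcN. Qed.

Lemma cmB x y : cm (x - y) <= cm x + cm y.
Proof. by rewrite -(cmN y) cmD. Qed.

Lemma cm_distC x y : cm (x - y) = cm (y - x).
Proof. by rewrite -cmN opprB. Qed.

Lemma cmM x y : cm (x * y) = cm x * cm y. Proof. exact: Normc.normcM. Qed.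

Lemma cm0 : cm 0 = 0. Proof. exact: Normc.normc0. Qed.
Lemma cm1 : cm 1 = 1. Proof. exact: Normc.normc1. Qed.

Lemma cmV x : cm x^-1 = (cm x)^-1. Proof. exact: Normc.normcV. Qed.

Lemma cmX x n : cm (x ^+ n) = cm x ^+ n.
Proof. by elim: n => [|n IH]; rewrite ?expr0 ?cm1 // !exprS cmM IH. Qed.

Lemma cm_eq0 x : cm x = 0 -> x = 0. Proof. exact: Normc.eq0_normc. Qed.

Lemma cm_gt0 x : x != 0 -> 0 < cm x.
Proof.
by move=> x0; rewrite lt0r cm_ge0 andbT; apply: contra x0 => /eqP/cm_eq0 ->.
Qed.

Lemma sqnJ z : sqn (conjc z) = sqn z.
Proof. by case: z => a b; rewrite /sqn /= sqrrN. Qed.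

Lemma cmJ z : cm (conjc z) = cm z.
Proof. by rewrite !cmE sqnJ. Qed.

Lemma cm_real (a : R) : cm (Complex a 0) = `|a|.
Proof. by rewrite cmE /sqn /= expr0n addr0 sqrtr_sqr. Qed.

Lemma Re_le_cm z : `|complex.Re z| <= cm z.
Proof. by rewrite cmE -sqrtr_sqr ler_wsqrtr // /sqn lerDl sqr_ge0. Qed.

Lemma Im_le_cm z : `|complex.Im z| <= cm z.
Proof. by rewrite cmE -sqrtr_sqr ler_wsqrtr // /sqn lerDr sqr_ge0. Qed.

Lemma cm_le z : cm z <= `|complex.Re z| + `|complex.Im z|.
Proof.
rewrite -[leRHS]ger0_norm ?addr_ge0 // -sqrtr_sqr cmE ler_wsqrtr //.
rewrite sqrrD !real_normK ?num_real // /sqn.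
by rewrite addrAC lerDl mulrn_wge0 // mulr_ge0.
Qed.

Lemma cm_sum (I : Type) (r : seq I) (P : pred I) (F : I -> C) :
  cm (\sum_(i <- r | P i) F i) <= \sum_(i <- r | P i) cm (F i).
Proof.
elim/big_ind2: _ => [|x a y b xa yb|//]; first by rewrite cm0.
by rewrite (le_trans (cmD _ _)) // lerD.
Qed.

Lemma mulcJ z : z * conjc z = Complex (sqn z) 0.
Proof. by case: z => a b; rewrite /sqn; simpc; congr Complex; ring. Qed.

Lemma sqnM x y : sqn (x * y) = sqn x * sqn y.
Proof. by rewrite -!cm_sqr cmM exprMn. Qed.

Lemma sqnN x : sqn (- x) = sqn x.
Proof. by rewrite -!cm_sqr cmN. Qed.

Lemma sqn0 : sqn (0 : C) = 0. Proof. by rewrite -cm_sqr cm0 expr0n. Qed.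

Lemma sqn_eq0 x : sqn x = 0 -> x = 0.
Proof. by rewrite -cm_sqr => /eqP; rewrite expf_eq0 /= => /eqP/cm_eq0. Qed.

Lemma ReD x y : complex.Re (x + y) = complex.Re x + complex.Re y.
Proof. by case: x; case: y. Qed.
Lemma ImD x y : complex.Im (x + y) = complex.Im x + complex.Im y.
Proof. by case: x; case: y. Qed.
Lemma ReN x : complex.Re (- x) = - complex.Re x.
Proof. by case: x. Qed.
Lemma ImN x : complex.Im (- x) = - complex.Im x.
Proof. by case: x. Qed.

Lemma ReM x y : complex.Re (x * y) =
  complex.Re x * complex.Re y - complex.Im x * complex.Im y.
Proof. by case: x; case: y. Qed.
Lemma ImM x y : complex.Im (x * y) =
  complex.Re x * complex.Im y + complex.Im x * complex.Re y.
Proof. by case: x; case: y. Qed.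

Lemma Re_sum (I : Type) (r : seq I) (P : pred I) (F : I -> C) :
  complex.Re (\sum_(i <- r | P i) F i) = \sum_(i <- r | P i) complex.Re (F i).
Proof. by elim/big_ind2: _ => [//|x a y b <- <-|//]; rewrite ReD. Qed.
Lemma Im_sum (I : Type) (r : seq I) (P : pred I) (F : I -> C) :
  complex.Im (\sum_(i <- r | P i) F i) = \sum_(i <- r | P i) complex.Im (F i).
Proof. by elim/big_ind2: _ => [//|x a y b <- <-|//]; rewrite ImD. Qed.

Lemma ReJ x : complex.Re (conjc x) = complex.Re x. Proof. by case: x. Qed.
Lemma ImJ x : complex.Im (conjc x) = - complex.Im x. Proof. by case: x. Qed.

Lemma complexP x y : complex.Re x = complex.Re y ->
  complex.Im x = complex.Im y -> x = y.
Proof. by case: x => a b; case: y => c d /= -> ->. Qed.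

Lemma disk_lt1 (z : disk R) : cm (val z) < 1.
Proof. by have := valP z; rewrite cm_norm -[1]/(Complex 1 0) ltcR. Qed.

Lemma mkdisk z : cm z < 1 -> `|z| < 1.
Proof. by move=> h; rewrite cm_norm -[1]/(Complex 1 0) ltcR. Qed.

End ComplexModulus.

Section ComplexLimits.
Variable R : realType.
Local Notation C := (R[i]).
Implicit Types (u v : nat -> C) (l k : C).

(** Convergence in modulus avoids splitting every estimate into real and imaginary parts; [ccvgP]
    links it to the componentwise limits of [cseries_to]. *)
Definition ccvg u l :=
  forall e : R, 0 < e -> exists N, forall n, (N <= n)%N -> cm (u n - l) < e.

Definition psum u (N : nat) : C := \sum_(n < N) u n.

Lemma ccvgP u l : ccvg u l <->
  ((fun n => complex.Re (u n)) @ \oo --> (complex.Re l : R) /\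
   (fun n => complex.Im (u n)) @ \oo --> (complex.Im l : R)).
Proof.
split=> [cu|[/cvgrPdist_lt cr /cvgrPdist_lt ci] e e0].
  split; apply/cvgrPdist_lt => e e0; have [N hN] := cu e e0;
    exists N => // n /= /hN; rewrite cm_distC; apply: le_lt_trans.
  - by rewrite -ReN -ReD Re_le_cm.
  - by rewrite -ImN -ImD Im_le_cm.
have e2 : 0 < e / 2 by rewrite divr_gt0.
have [N _ hN] := cr _ e2; have [M _ hM] := ci _ e2.
exists (maxn N M) => n; rewrite geq_max => /andP[/hN /= h1 /hM /= h2].
rewrite cm_distC (le_lt_trans (cm_le _)) // ReD ImD ReN ImN.
by rewrite [ltRHS](splitr e) ltrD.
Qed.

Lemma cseries_toP u l : cseries_to u l <-> ccvg (psum u) l.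
Proof. by rewrite ccvgP. Qed.

Lemma ccvg_ext u v l : u =1 v -> ccvg u l -> ccvg v l.
Proof. by move=> /funext ->. Qed.

Lemma ccvg_cst l : ccvg (fun=> l) l.
Proof. by move=> e e0; exists 0%N => n _; rewrite subrr cm0. Qed.

Lemma ccvg_uniq u l k : ccvg u l -> ccvg u k -> l = k.
Proof.
move=> ul uk; apply/eqP/contraT => lk.
have e0 : 0 < cm (l - k) / 2 by rewrite divr_gt0 // cm_gt0 // subr_eq0.
have [N hN] := ul _ e0; have [M hM] := uk _ e0.
have := hN (maxn N M) (leq_maxl _ _); have := hM (maxn N M) (leq_maxr _ _).
set x := u _ => h1 h2; have : cm (l - k) < cm (l - k); last by rewrite ltxx.
rewrite {1}(_ : l - k = (x - k) - (x - l)); last by ring.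
by rewrite [ltRHS]splitr (le_lt_trans (cmB _ _)) // ltrD.
Qed.

Lemma ccvgD u v l k : ccvg u l -> ccvg v k -> ccvg (fun n => u n + v n) (l + k).
Proof.
move=> ul vk e e0; have e2 : 0 < e / 2 by rewrite divr_gt0.
have [N hN] := ul _ e2; have [M hM] := vk _ e2.
exists (maxn N M) => n; rewrite geq_max => /andP[/hN h1 /hM h2].
rewrite (_ : _ - _ = (u n - l) + (v n - k)); last by ring.
by rewrite (le_lt_trans (cmD _ _)) // [ltRHS]splitr ltrD.
Qed.

Lemma ccvg_lip u v l k (B : R) :
  (forall n, cm (v n - k) <= B * cm (u n - l)) -> ccvg u l -> ccvg v k.
Proof.
move=> h ul e e0.
have B0 : 0 < `|B| + 1 by rewrite ltr_wpDl.
have [N hN] := ul (e / (`|B| + 1)) (divr_gt0 e0 B0).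
exists N => n /hN; rewrite ltr_pdivlMr // mulrC; apply: le_lt_trans.
rewrite (le_trans (h n)) // ler_wpM2r ?cm_ge0 //.
by rewrite (le_trans (ler_norm _)) // lerDl.
Qed.

Lemma ccvgZ (c : C) u l : ccvg u l -> ccvg (fun n => c * u n) (c * l).
Proof. by apply: (@ccvg_lip _ _ _ _ (cm c)) => n; rewrite -mulrBr cmM. Qed.

Lemma ccvgJ u l : ccvg u l -> ccvg (fun n => conjc (u n)) (conjc l).
Proof. by apply: (@ccvg_lip _ _ _ _ 1) => n; rewrite -rmorphB /= cmJ mul1r. Qed.

Lemma ccvg_bounded u l : ccvg u l -> exists B : R, forall n, cm (u n) <= B.
Proof.
move=> ul; have [N hN] := ul 1 ltr01.
exists (\sum_(i < N) cm (u i) + (cm l + 1)) => n.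
have [Nn|nN] := leqP N n.
  rewrite -{1}(subrK l (u n)) (le_trans (cmD _ _)) //.
  rewrite -[leLHS]add0r lerD //.
    by apply: sumr_ge0 => *; apply: cm_ge0.
  by rewrite addrC lerD2l ltW // hN.
rewrite (bigD1 (Ordinal nN)) //= -addrA lerDl; apply: addr_ge0.
  by apply: sumr_ge0 => *; apply: cm_ge0.
by rewrite addr_ge0 // cm_ge0.
Qed.

Lemma ccvg_shift u l (k : nat) : ccvg (fun n => u (k + n)%N) l -> ccvg u l.
Proof.
move=> ul e /ul[N hN]; exists (k + N)%N => n kn.
by have := hN (n - k)%N; rewrite subnKC; [apply; lia|lia].
Qed.

Lemma geo_small (B t : R) : 0 <= t < 1 -> forall e : R, 0 < e ->
  exists N, forall n, (N <= n)%N -> B * t ^+ n < e.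
Proof.
move=> /andP[t0 t1] e e0.
have /cvgrPdist_lt/(_ _ e0)[N _ hN] := @cvg_geometric R B t (eq_ind_r (fun x => x < 1) t1 (ger0_norm t0)).
exists N => n /hN /=; rewrite sub0r normrN; apply: le_lt_trans; exact: ler_norm.
Qed.

Lemma ccvg_geo u l (B t : R) : 0 <= t < 1 ->
  (forall n, cm (u n - l) <= B * t ^+ n) -> ccvg u l.
Proof.
move=> t01 h e e0; have [N hN] := geo_small B t01 e0.
by exists N => n /hN; apply: le_lt_trans.
Qed.

Lemma psum_abs_cvg u (B : R) : (forall N, \sum_(n < N) cm (u n) <= B) ->
  exists l, ccvg (psum u) l.
Proof.
move=> hB.
have cc (f : C -> R) : (forall z, `|f z| <= cm z) ->
    cvgn (series (fun n => f (u n))).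
  move=> hf; apply: normed_cvg; apply: (@series_le_cvg _ _ (fun n => cm (u n))).
  - by move=> n; exact: normr_ge0.
  - by move=> n; exact: cm_ge0.
  - by move=> n; exact: hf.
  apply: nondecreasing_is_cvgn.
    move=> n m nm; rewrite /series /= (big_cat_nat (leq0n n) nm) /= lerDl sumr_ge0 //.
    by move=> *; exact: cm_ge0.
  by exists B => _ [n _ <-]; rewrite /series /= big_mkord.
have cr := cc _ (@Re_le_cm R); have ci := cc _ (@Im_le_cm R).
exists (Complex (limn (series (fun n => complex.Re (u n))))
                (limn (series (fun n => complex.Im (u n))))).
apply/ccvgP; split.
  rewrite (_ : (fun n => _) = series (fun n => complex.Re (u n))) //.
  by apply/funext => n; rewrite /series /= /psum Re_sum big_mkord.
rewrite (_ : (fun n => _) = series (fun n => complex.Im (u n))) //.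
by apply/funext => n; rewrite /series /= /psum Im_sum big_mkord.
Qed.

Lemma psum_nat u (m n : nat) : (m <= n)%N ->
  psum u n - psum u m = \sum_(m <= k < n) u k.
Proof.
by move=> mn; rewrite /psum -!(big_mkord xpredT) (big_cat_nat (leq0n m) mn) /= addrAC subrr add0r.
Qed.

Lemma geo_sum_le (t : R) (N : nat) : 0 <= t < 1 ->
  \sum_(n < N) t ^+ n <= (1 - t)^-1.
Proof.
move=> /andP[t0 t1]; have h : 0 < 1 - t by rewrite subr_gt0.
rewrite -[leRHS]mul1r ler_pdivlMr // mulrC.
rewrite -opprB mulNr -subrX1 opprB lerBlDr lerDl exprn_ge0 //.
Qed.

Lemma psum_tail u l (B t : R) (N : nat) : 0 <= t < 1 ->
  (forall n, cm (u n) <= B * t ^+ n) -> ccvg (psum u) l ->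
  cm (l - psum u N) <= B * t ^+ N / (1 - t).
Proof.
move=> t01 hu ul; have /andP[t0 t1] := t01.
have B0 : 0 <= B by have := hu 0%N; rewrite expr0 mulr1; apply: le_trans (cm_ge0 _).
apply/ler_addgt0Pr => e e0; have [M hM] := ul e e0.
set n := maxn N M.
rewrite (_ : l - psum u N = (psum u n - psum u N) - (psum u n - l)); last by ring.
rewrite (le_trans (cmB _ _)) // lerD //; last by rewrite ltW // hM // leq_maxr.
rewrite psum_nat ?leq_maxl // (le_trans (cm_sum _ _ _)) //.
rewrite -{1}(add0n N) big_addn big_mkord.
apply: (@le_trans _ _ (\sum_(i < n - N) (B * t ^+ N) * t ^+ i)).
  by apply: ler_sum => i _; rewrite -mulrA -exprD addnC hu.
by rewrite -mulr_sumr ler_wpM2l ?geo_sum_le // mulr_ge0 // exprn_ge0.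
Qed.

End ComplexLimits.

(** * Power series *)

Section PowerSeries.
Variable R : realType.
Local Notation C := (R[i]).
Implicit Types (a b d u v : nat -> C) (l k : C) (f h : disk R -> C).

Definition conv a b (n : nat) : C := \sum_(k < n.+1) a k * b (n - k)%N.

Definition shift (k : nat) a (n : nat) : C := if (n < k)%N then 0 else a (n - k)%N.

Definition delta (j n : nat) : C := (n == j)%:R.

(** Radius of convergence at least 1, in the form that yields geometric domination on every smaller
    disk ([tame_dom]). *)
Definition tame a := forall rho : R, 0 < rho < 1 ->
  exists B : R, forall n, cm (a n) * rho ^+ n <= B.

Lemma convC a b : conv a b =1 conv b a.
Proof.
move=> n; rewrite /conv (reindex_inj rev_ord_inj) /=; apply: eq_bigr => i _.
rewrite subSS mulrC subKn //; first by have := ltn_ord i; lia.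
Qed.

Lemma conv_psum u v N : psum (conv u v) N = \sum_(i < N) u i * psum v (N - i).
Proof.
elim: N => [|N IH]; first by rewrite /psum !big_ord0.
rewrite /psum big_ord_recr -/(psum _ _) /= IH.
transitivity (\sum_(i < N.+1) (u i * psum v (N - i) + u i * v (N - i)%N)).
  rewrite big_split /= -/(conv u v N); congr (_ + _).
  by rewrite big_ord_recr /= subnn /psum big_ord0 mulr0 addr0.
apply: eq_bigr => i _; rewrite subSn; last by have := ltn_ord i; lia.
by rewrite /psum big_ord_recr /= mulrDr.
Qed.

Lemma natr_geo_le (s : R) N : 0 <= s < 1 -> N%:R * s ^+ N <= (1 - s)^-1.
Proof.
move=> s01; apply: le_trans (geo_sum_le N s01); have /andP[s0 s1] := s01.
rewrite -[N in N%:R]card_ord -sum1_card natr_sum mulr_suml.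
apply: ler_sum => i _; rewrite mul1r ler_wiXn2l //; first exact: ltW.
exact: ltnW.
Qed.

Lemma conv_cvg u v l k (B D t : R) : 0 <= t < 1 ->
  (forall n, cm (u n) <= B * t ^+ n) -> (forall n, cm (v n) <= D * t ^+ n) ->
  ccvg (psum u) l -> ccvg (psum v) k -> ccvg (psum (conv u v)) (l * k).
Proof.
move=> t01 hu hv ul vk; have /andP[t0 t1] := t01.
have B0 : 0 <= B by have := hu 0%N; rewrite expr0 mulr1; apply: le_trans (cm_ge0 _).
have D0 : 0 <= D by have := hv 0%N; rewrite expr0 mulr1; apply: le_trans (cm_ge0 _).
(* The error of the Cauchy product is a sum of [N] terms of size [t^N]. Writing [t = s * s] absorbs
   the factor [N], since [N s^N <= 1 / (1 - s)]. *)
pose s := Num.sqrt t.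
have s0 : 0 <= s by rewrite sqrtr_ge0.
have s1 : s < 1 by rewrite -sqrtr1 ltr_sqrt.
have s01 : 0 <= s < 1 by rewrite s0.
have ts : t = s * s by rewrite -expr2 sqr_sqrtr.
have t1i : 0 <= (1 - t)^-1 by rewrite invr_ge0 subr_ge0 ltW.
apply: (@ccvg_ext _ (fun N => \sum_(i < N) u i * (psum v (N - i) - k)
    + (psum u N - l) * k + l * k)).
  move=> N; rewrite conv_psum.
  under eq_bigr do rewrite mulrBr.
  by rewrite sumrB -mulr_suml -/(psum u N); ring.
rewrite -[X in ccvg _ X]add0r -[X in ccvg _ (X + _)]addr0.
apply: ccvgD; last exact: ccvg_cst.
apply: ccvgD; last first.
  apply: (ccvg_lip (B := cm k) _ ul) => n.
  by rewrite subr0 cmM mulrC.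
apply: (@ccvg_geo _ _ _ (B * D / (1 - t) / (1 - s)) s) => // N.
rewrite subr0 (le_trans (cm_sum _ _ _)) //.
apply: (@le_trans _ _ (\sum_(i < N) (B * D / (1 - t)) * t ^+ N)).
  apply: ler_sum => i _; rewrite cmM cm_distC.
  have iN : (i <= N)%N by exact: ltnW.
  rewrite (_ : t ^+ N = t ^+ i * t ^+ (N - i)); last by rewrite -exprD subnKC.
  rewrite [leRHS](_ : _ = (B * t ^+ i) * (D * t ^+ (N - i) / (1 - t))); last by ring.
  by rewrite ler_pM ?cm_ge0 //; apply: psum_tail.
rewrite -mulr_sumr -[leRHS]mulrA ler_wpM2l ?mulr_ge0 //.
rewrite sumr_const card_ord -mulr_natl ts exprMn mulrA ler_wpM2r ?exprn_ge0 //.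
exact: natr_geo_le.
Qed.

Lemma tame_dom a (r : R) : tame a -> 0 <= r < 1 -> exists B t : R,
  [/\ 0 <= t < 1, 0 <= B & forall z : C, cm z <= r ->
   forall n, cm (a n * z ^+ n) <= B * t ^+ n].
Proof.
(* A radius strictly between [r] and 1: boundedness at [rho] becomes decay with ratio [r / rho] on
   the disk of radius [r]. *)
move=> ta /andP[r0 r1]; pose rho := (1 + r) / 2.
have rho0 : 0 < rho by rewrite /rho divr_gt0 // ltr_pwDl.
have [B hB] : exists B : R, forall n, cm (a n) * rho ^+ n <= B.
  by apply: ta; rewrite rho0 /= /rho; lra.
have B0 : 0 <= B by have := hB 0%N; rewrite expr0 mulr1; apply: le_trans (cm_ge0 _).
exists B, (r / rho); split => //.
  by rewrite divr_ge0 ?(ltW rho0) //= ltr_pdivrMr // mul1r /rho; lra.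
move=> z zr n; rewrite cmM cmX.
rewrite [leRHS](_ : _ = B / rho ^+ n * r ^+ n); last by rewrite expr_div_n; ring.
apply: ler_pM; rewrite ?cm_ge0 ?exprn_ge0 ?cm_ge0 //.
  by rewrite ler_pdivlMr ?exprn_gt0.
by rewrite lerXn2r // nnegrE cm_ge0.
Qed.

Lemma psum_terms_bounded u l : ccvg (psum u) l ->
  exists B : R, forall n, cm (u n) <= B.
Proof.
move=> /ccvg_bounded[B hB]; exists (B + B) => n.
rewrite (_ : u n = psum u n.+1 - psum u n).
  by rewrite (le_trans (cmB _ _)) // lerD.
by rewrite /psum big_ord_recr /= addrAC subrr add0r.
Qed.

Lemma is_taylorP a f : is_taylor a f <->
  forall z : disk R, ccvg (psum (fun n => a n * (val z) ^+ n)) (f z).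
Proof. by split=> h z; apply/cseries_toP. Qed.

Definition rdisk (r : R) (r1 : `|r| < 1) : disk R :=
  exist _ (Complex r 0) (mkdisk (eq_ind_r (fun x => x < 1) r1 (cm_real r))).

Lemma taylor_tame a f : is_taylor a f -> tame a.
Proof.
move=> /is_taylorP af rho /andP[rho0 rho1].
have r1 : `|rho| < 1 by rewrite gtr0_norm.
have [B hB] := psum_terms_bounded (af (rdisk r1)).
by exists B => n; have := hB n; rewrite cmM cmX cm_real gtr0_norm.
Qed.

Lemma tame_geo a z : tame a -> cm z < 1 -> exists l, ccvg (psum (fun n => a n * z ^+ n)) l.
Proof.
move=> ta z1; have [|B [t [t01 B0 hB]]] := @tame_dom a (cm z) ta.
  by rewrite cm_ge0.
apply: (@psum_abs_cvg _ _ (B / (1 - t))) => N.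
apply: (@le_trans _ _ (\sum_(n < N) B * t ^+ n)).
  by apply: ler_sum => n _; exact: hB.
by rewrite -mulr_sumr ler_wpM2l // geo_sum_le.
Qed.

Lemma tame_bounded a (B : R) : (forall n, cm (a n) <= B) -> tame a.
Proof.
move=> hB rho /andP[rho0 rho1]; exists B => n.
rewrite (le_trans _ (hB n)) // ler_piMr ?cm_ge0 //.
by rewrite exprn_ile1 // ltW.
Qed.

Lemma conv_geo a b (z : C) n :
  conv a b n * z ^+ n = conv (fun n => a n * z ^+ n) (fun n => b n * z ^+ n) n.
Proof.
rewrite /conv mulr_suml; apply: eq_bigr => i _.
rewrite (_ : z ^+ n = z ^+ i * z ^+ (n - i)); first by ring.
by rewrite -exprD subnKC // -ltnS.
Qed.

Lemma taylor_mul a b f h : is_taylor a f -> is_taylor b h ->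
  is_taylor (conv a b) (fun z => f z * h z).
Proof.
move=> taf tbh; have ta := taylor_tame taf; have tb := taylor_tame tbh.
apply/is_taylorP => z.
have z01 : 0 <= cm (val z) < 1 by rewrite cm_ge0 disk_lt1.
have [A [s [s01 A0 hA]]] := tame_dom ta z01.
have [B [t [t01 B0 hB]]] := tame_dom tb z01.
move: taf tbh => /is_taylorP/(_ z) az /is_taylorP/(_ z) bz.
rewrite (_ : (fun n => _) = conv (fun n => a n * val z ^+ n) (fun n => b n * val z ^+ n)).
  2: by apply/funext => n; exact: conv_geo.
have /andP[s0 s1] := s01; have /andP[t0 t1] := t01.
apply: (@conv_cvg _ _ _ _ A B (Num.max s t)) => //.
- by rewrite le_max s0 /= gt_max s1.
- move=> n; rewrite (le_trans (hA _ (lexx _) n)) // ler_wpM2l //.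
  by rewrite lerXn2r ?nnegrE // ?le_max ?s0 ?lexx.
- move=> n; rewrite (le_trans (hB _ (lexx _) n)) // ler_wpM2l //.
  by rewrite lerXn2r ?nnegrE // ?le_max ?s0 ?lexx ?orbT.
Qed.

Lemma taylor_lin a b f h (c : C) : is_taylor a f -> is_taylor b h ->
  is_taylor (fun n => c * a n + b n) (fun z => c * f z + h z).
Proof.
move=> /is_taylorP af /is_taylorP bh; apply/is_taylorP => z.
apply: ccvg_ext (ccvgD (ccvgZ c (af z)) (bh z)) => N.
rewrite /psum mulr_sumr -big_split /=; apply: eq_bigr => i _.
by ring.
Qed.

Lemma taylor0 : is_taylor (fun=> 0) (fun=> 0 : C).
Proof.
apply/is_taylorP => z; apply: ccvg_ext (ccvg_cst 0) => N.
by rewrite /psum big1 // => i _; rewrite mul0r.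
Qed.

Lemma taylor_delta j : is_taylor (delta j) (fun z => val z ^+ j).
Proof.
apply/is_taylorP => z; apply: (@ccvg_shift _ _ _ j.+1).
apply: ccvg_ext (ccvg_cst _) => N.
have jN : (j < j.+1 + N)%N by lia.
rewrite /psum (bigD1 (Ordinal jN)) //= /delta eqxx mul1r big1 ?addr0 // => i ij.
rewrite (_ : (_ == _) = false) ?mul0r //.
by apply/negbTE; apply: contra ij => /eqP e; apply/eqP/val_inj.
Qed.

Lemma conv_delta j a : conv (delta j) a =1 shift j a.
Proof.
move=> n; rewrite /conv /shift; case: ltnP => [nj|jn].
  rewrite big1 // => i _; rewrite /delta (_ : (_ == _) = false) ?mul0r //.
  by have := ltn_ord i; lia.
have jn1 : (j < n.+1)%N by [].
rewrite (bigD1 (Ordinal jn1)) //= /delta eqxx mul1r big1 ?addr0 // => i ij.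
rewrite (_ : (_ == _) = false) ?mul0r //.
by apply/negbTE; apply: contra ij => /eqP e; apply/eqP/val_inj.
Qed.

Lemma taylor_shift j a f : is_taylor a f ->
  is_taylor (shift j a) (fun z => val z ^+ j * f z).
Proof.
by move=> h; rewrite -(funext (conv_delta j a)); apply: taylor_mul => //; exact: taylor_delta.
Qed.

(** If the coefficients before [d n] vanish, then at a small real point [s] the term [d n * s^n]
    must cancel the tail of the series, which is at most [2 B (2 s)^(n+1)]; letting [s] be small
    enough contradicts [d n != 0]. *)
Lemma taylor_zero_uniq d : is_taylor d (fun=> 0) -> d =1 fun=> 0.
Proof.
move=> td; have dt := taylor_tame td; have [B hB] := dt (1 / 2) ltac:(lra).
have B0 : 0 <= B by have := hB 0%N; rewrite expr0 mulr1; apply: le_trans (cm_ge0 _).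
move=> n; elim/ltn_ind: n => n IH.
apply: cm_eq0; apply/eqP; rewrite eq_le cm_ge0 andbT leNgt; apply/negP => dn.
(* The point will be [s = |d n| / D]. The first summand of [D] makes the tail smaller than
   [|d n| s^n]; the second gives [s <= 1/4], so that the ratio [2 s] is at most [1/2]. *)
pose D := 2 * B * 2 ^+ n.+1 + 4 * cm (d n).
have D0 : 0 < D by rewrite ltr_wpDl ?mulr_ge0 ?exprn_ge0 // mulr_gt0.
have [s [s0 s4 sD]] : exists s : R,
    [/\ 0 < s, s <= 1 / 4 & 2 * B * 2 ^+ n.+1 * s < cm (d n)].
  exists (cm (d n) / D); split; first by rewrite divr_gt0.
    rewrite ler_pdivrMr // /D mulrDr.
    by rewrite -[leLHS]add0r lerD //; [rewrite !mulr_ge0 // exprn_ge0|lra].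
  by rewrite mulrA ltr_pdivrMr // [ltLHS]mulrC ltr_pM2l // /D ltrDl mulr_gt0.
have s1 : `|s| < 1 by rewrite gtr0_norm //; lra.
move: td => /is_taylorP/(_ (rdisk s1)) /= tz.
have t01 : 0 <= 2 * s < 1 by lra.
have := psum_tail (B := B) n.+1 t01 _ tz; set P := psum _ _.
have -> : P = d n * (Complex s 0) ^+ n.
  rewrite /P /psum big_ord_recr /= big1 ?add0r // => i _.
  by rewrite IH ?mul0r.
rewrite sub0r cmN cmM cmX cm_real gtr0_norm // => h.
have /h {}h : forall m, cm (d m * Complex s 0 ^+ m) <= B * (2 * s) ^+ m.
  move=> m; rewrite cmM cmX cm_real gtr0_norm // exprMn mulrA.

  rewrite ler_wpM2r ?exprn_ge0 ?(ltW s0) //.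
  by have := hB m; rewrite expr_div_n expr1n mul1r ler_pdivrMr ?exprn_gt0.
have {}h : cm (d n) * s ^+ n <= 2 * (B * (2 * s) ^+ n.+1).
  have i2 : (1 - 2 * s)^-1 <= 2 by rewrite -[leLHS]mul1r ler_pdivrMr; lra.
  apply: le_trans h _; rewrite [leRHS]mulrC; apply: ler_wpM2l => //.
  by rewrite mulr_ge0 ?exprn_ge0 ?mulr_ge0 // ltW.
have : cm (d n) < cm (d n); last by rewrite ltxx.
have : cm (d n) <= 2 * B * 2 ^+ n.+1 * s.
  rewrite -(ler_pM2r (exprn_gt0 n s0)); apply: le_trans h _.
  by rewrite exprMn [s ^+ n.+1]exprS !mulrA le_eqVlt; apply/orP; left; apply/eqP; ring.
by move=> /le_lt_trans; apply.
Qed.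

Lemma taylor_uniq a b f : is_taylor a f -> is_taylor b f -> a = b.
Proof.
move=> ta tb; apply/funext => n.
have /taylor_zero_uniq/(_ n)/eqP : is_taylor (fun n => -1 * b n + a n) (fun=> 0).
  rewrite (_ : (fun=> 0) = fun z => -1 * f z + f z); first exact: taylor_lin.
  by apply/funext => z; ring.
by rewrite mulN1r addrC subr_eq0 => /eqP.
Qed.

End PowerSeries.

(** * Square-summable sequences *)

Section SquareSummable.
Variable R : realType.
Local Notation C := (R[i]).
Implicit Types (a b d u v : nat -> C) (c : C).

Definition l2 a := exists B : R, forall N, \sum_(n < N) sqn (a n) <= B.

(** Total, with value 0 when there is no limit, so that [ip] can be written without a convergence
    proof; [ip_cvg] shows that the limit exists for square-summable sequences. *)
Definition clim u : C := xget 0 [set l | ccvg u l].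

Lemma climE u l : ccvg u l -> clim u = l.
Proof.
move=> h; have h' : ccvg u (clim u) by apply: (@xgetPex _ 0 [set l | ccvg u l]); exists l.
exact: ccvg_uniq h' h.
Qed.

Definition ip a b : C := clim (psum (fun n => a n * conjc (b n))).
Definition nrm2 a : R := complex.Re (ip a a).
Definition nrm a : R := Num.sqrt (nrm2 a).

Definition lin c a b n := c * a n + b n.
Definition trunc (N : nat) a n : C := if (n < N)%N then a n else 0.

Lemma psqn_mono a (N M : nat) : (N <= M)%N ->
  \sum_(n < N) sqn (a n) <= \sum_(n < M) sqn (a n).
Proof.
move=> NM; rewrite -!(big_mkord xpredT (fun n => sqn (a n))).
rewrite (big_cat_nat (leq0n N) NM) /= lerDl sumr_ge0 // => *; exact: sqn_ge0.
Qed.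

Lemma sqnD_le (x y : C) : sqn (x + y) <= 2 * sqn x + 2 * sqn y.
Proof.
case: x => x1 x2; case: y => y1 y2; rewrite /sqn /= -subr_ge0.
rewrite (_ : _ - _ = (x1 - y1) ^+ 2 + (x2 - y2) ^+ 2); last by ring.
by rewrite addr_ge0 ?sqr_ge0.
Qed.

Lemma l2_lin c a b : l2 a -> l2 b -> l2 (lin c a b).
Proof.
move=> [A hA] [B hB]; exists (2 * sqn c * A + 2 * B) => N.
apply: (@le_trans _ _ (\sum_(n < N) (2 * sqn c * sqn (a n) + 2 * sqn (b n)))).
  by apply: ler_sum => n _; rewrite (le_trans (sqnD_le _ _)) // sqnM mulrA.
rewrite big_split /= -!mulr_sumr; apply: lerD.
  by apply: ler_wpM2l (hA N); rewrite mulr_ge0 // sqn_ge0.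
exact: ler_wpM2l (hB N).
Qed.

Lemma l2_0 : l2 (fun=> 0).
Proof. by exists 0 => N; rewrite big1 // => *; rewrite sqn0. Qed.

Lemma l2D a b : l2 a -> l2 b -> l2 (fun n => a n + b n).
Proof.
move=> la lb; rewrite (_ : (fun n => _) = lin 1 a b); first exact: l2_lin.
by apply/funext => n; rewrite /lin mul1r.
Qed.

Lemma l2B a b : l2 a -> l2 b -> l2 (fun n => a n - b n).
Proof.
move=> la lb; rewrite (_ : (fun n => _) = lin (-1) b a); first exact: l2_lin.
by apply/funext => n; rewrite /lin mulN1r addrC.
Qed.

Lemma l2Z c a : l2 a -> l2 (fun n => c * a n).
Proof.
move=> la; rewrite (_ : (fun n => _) = lin c a (fun=> 0)).
  exact: l2_lin l2_0.
by apply/funext => n; rewrite /lin addr0.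
Qed.

Lemma l2_sum (I : Type) (r : seq I) (F : I -> nat -> C) (x : I -> C) :
  (forall i, l2 (F i)) -> l2 (fun n => \sum_(i <- r) x i * F i n).
Proof.
move=> lF; elim: r => [|i r IH].
  rewrite (_ : (fun n => _) = fun=> 0); first exact: l2_0.
  by apply/funext => n; rewrite big_nil.
rewrite (_ : (fun n => _) = lin (x i) (F i) (fun n => \sum_(j <- r) x j * F j n)).
  exact: l2_lin.
by apply/funext => n; rewrite big_cons.
Qed.

Lemma l2_finite N a : (forall n, (N <= n)%N -> a n = 0) -> l2 a.
Proof.
move=> h; exists (\sum_(n < N) sqn (a n)) => M.
have [MN|NM] := leqP M N; first exact: psqn_mono.
rewrite -!(big_mkord xpredT (fun n => sqn (a n))) (big_cat_nat (leq0n N) (ltnW NM)) /=.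
rewrite [X in _ + X]big_nat_cond [X in _ + X]big1 ?addr0 // => i /andP[/andP[Ni _] _].
by rewrite h ?sqn0.
Qed.

Lemma l2_trunc N a : l2 (trunc N a).
Proof. by apply: (@l2_finite N) => n Nn; rewrite /trunc ltnNge Nn. Qed.

Lemma l2_delta j : l2 (@delta R j).
Proof.
apply: (@l2_finite j.+1) => n jn; rewrite /delta.
by rewrite (_ : (n == j) = false) //; lia.
Qed.

Lemma shift_sum k (F : C -> R) a N : F 0 = 0 ->
  \sum_(n < k + N) F (shift k a n) = \sum_(n < N) F (a n).
Proof.
move=> F0; rewrite big_split_ord /= big1 ?add0r => [|i _].
  by apply: eq_bigr => i _; rewrite /shift ltnNge leq_addr /= addKn.
by rewrite /shift ltn_ord.
Qed.

Lemma l2_shift k a : l2 a -> l2 (shift k a).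
Proof.
move=> [B hB]; exists B => N.
by rewrite (le_trans (psqn_mono _ (leq_addl k N))) // shift_sum // sqn0.
Qed.

Lemma l2_unshift k a : l2 (shift k a) -> l2 a.
Proof.
move=> [B hB]; exists B => N; have := hB (k + N)%N.
by rewrite shift_sum // sqn0.
Qed.

Lemma cm_mul_le (x y : C) : cm (x * conjc y) <= sqn x + sqn y.
Proof.
rewrite cmM cmJ -!cm_sqr; have := cm_ge0 x; have := cm_ge0 y.
set p := cm x; set q := cm y => q0 p0.
have := sqr_ge0 (p - q); have := mulr_ge0 p0 q0; nra.
Qed.

Lemma ip_cvg a b : l2 a -> l2 b ->
  ccvg (psum (fun n => a n * conjc (b n))) (ip a b).
Proof.
move=> [A hA] [B hB].
have [|l hl] := @psum_abs_cvg _ (fun n => a n * conjc (b n)) (A + B).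
  move=> N; apply: (@le_trans _ _ (\sum_(n < N) (sqn (a n) + sqn (b n)))).
    by apply: ler_sum => n _; exact: cm_mul_le.
  by rewrite big_split /=; exact: lerD (hA N) (hB N).
by rewrite /ip (climE hl).
Qed.

Lemma ipE a b l : ccvg (psum (fun n => a n * conjc (b n))) l -> ip a b = l.
Proof. exact: climE. Qed.

Lemma ipC a b : l2 a -> l2 b -> ip b a = conjc (ip a b).
Proof.
move=> la lb; apply: ipE; apply: ccvg_ext (ccvgJ (ip_cvg la lb)) => N.
rewrite /psum rmorph_sum /=; apply: eq_bigr => i _.
by rewrite rmorphM /= conjcK mulrC.
Qed.

Lemma ip_linl c a b d : l2 a -> l2 b -> l2 d ->
  ip (lin c a b) d = c * ip a d + ip b d.
Proof.
move=> la lb ld; apply: ipE.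
apply: ccvg_ext (ccvgD (ccvgZ c (ip_cvg la ld)) (ip_cvg lb ld)) => N.
rewrite /psum mulr_sumr -big_split /=; apply: eq_bigr => i _.
by rewrite /lin mulrDl mulrA.
Qed.

Lemma ip_linr c a b d : l2 a -> l2 b -> l2 d ->
  ip d (lin c a b) = conjc c * ip d a + ip d b.
Proof.
move=> la lb ld; rewrite ipC ?ip_linl //; last exact: l2_lin.
by rewrite rmorphD rmorphM /= -!ipC.
Qed.

Lemma ip0l a : ip (fun=> 0) a = 0.
Proof.
apply: ipE; apply: ccvg_ext (ccvg_cst 0) => N.
by rewrite /psum big1 // => *; rewrite mul0r.
Qed.

Lemma ip_suml (I : Type) (r : seq I) (F : I -> nat -> C) (x : I -> C) b :
  (forall i, l2 (F i)) -> l2 b ->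
  ip (fun n => \sum_(i <- r) x i * F i n) b = \sum_(i <- r) x i * ip (F i) b.
Proof.
move=> lF lb; elim: r => [|i r IH].
  rewrite (_ : (fun n => _) = fun=> 0); first by rewrite ip0l big_nil.
  by apply/funext => n; rewrite big_nil.
rewrite (_ : (fun n => _) = lin (x i) (F i) (fun n => \sum_(j <- r) x j * F j n)).
  by rewrite ip_linl ?IH ?big_cons //; exact: l2_sum.
by apply/funext => n; rewrite big_cons.
Qed.

Lemma ip_sumr (I : Type) (r : seq I) (F : I -> nat -> C) (x : I -> C) b :
  (forall i, l2 (F i)) -> l2 b ->
  ip b (fun n => \sum_(i <- r) x i * F i n) = \sum_(i <- r) conjc (x i) * ip b (F i).
Proof.
move=> lF lb; rewrite ipC //; last exact: l2_sum.
rewrite ip_suml // rmorph_sum /=; apply: eq_bigr => i _.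
by rewrite rmorphM /= -ipC.
Qed.

Lemma ip_shift k a b : l2 a -> l2 b -> ip (shift k a) (shift k b) = ip a b.
Proof.
move=> la lb; apply: ipE; apply: (@ccvg_shift _ _ _ k).
apply: ccvg_ext (ip_cvg la lb) => N; rewrite /psum big_split_ord /=.
rewrite [in RHS]big1 ?add0r => [|i _].
  by apply: eq_bigr => i _; rewrite /shift ltnNge leq_addr /= addKn.
by rewrite /shift ltn_ord mul0r.
Qed.

Lemma ip_truncl N a b : ip (trunc N a) b = \sum_(n < N) a n * conjc (b n).
Proof.
apply: ipE; apply: (@ccvg_shift _ _ _ N).
apply: ccvg_ext (ccvg_cst _) => M; rewrite /psum big_split_ord /=.
rewrite [X in _ + X]big1 ?addr0 => [|i _].
  by apply: eq_bigr => i _; rewrite /trunc ltn_ord.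
by rewrite /trunc ltnNge leq_addr /= mul0r.
Qed.

Lemma ip_self a : l2 a -> ip a a = Complex (nrm2 a) 0.
Proof.
move=> la; have := ipC la la; rewrite /nrm2; case: (ip a a) => x y [/= h].
by congr Complex; lra.
Qed.

Lemma nrm2_partial a N : l2 a -> \sum_(n < N) sqn (a n) <= nrm2 a.
Proof.
move=> la; apply/ler_addgt0Pr => e e0; have [M hM] := ip_cvg la la e0.
have := hM (maxn N M) (leq_maxr _ _); rewrite cm_distC.
move=> /(le_lt_trans (Re_le_cm _)); rewrite ReD ReN -/(nrm2 a) /psum Re_sum.
under eq_bigr do rewrite mulcJ /=.
have := psqn_mono a (leq_maxl N M); set x := \sum_(_ < maxn _ _) _.
by move=> h1; rewrite ltr_norml => /andP[h2 _]; lra.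
Qed.

Lemma nrm2_le a (B : R) : (forall N, \sum_(n < N) sqn (a n) <= B) -> nrm2 a <= B.
Proof.
move=> hB; have la : l2 a by exists B.
apply/ler_addgt0Pr => e e0; have [M hM] := ip_cvg la la e0.
have := hM M (leqnn _); rewrite cm_distC.
move=> /(le_lt_trans (Re_le_cm _)); rewrite ReD ReN -/(nrm2 a) /psum Re_sum.
under eq_bigr do rewrite mulcJ /=.
by have := hB M; set x := \sum_(_ < M) _ => h /(le_lt_trans (ler_norm _)); lra.
Qed.

Lemma nrm2_approx a (e : R) : l2 a -> 0 < e ->
  exists N, nrm2 a - e < \sum_(n < N) sqn (a n).
Proof.
move=> la e0; apply: contrapT => h.
suff : nrm2 a <= nrm2 a - e by lra.
apply: nrm2_le => N; rewrite leNgt; apply/negP => hN; apply: h; by exists N.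
Qed.

Lemma nrm2_ge0 a : l2 a -> 0 <= nrm2 a.
Proof. by move=> /(nrm2_partial 0); rewrite big_ord0. Qed.

Lemma nrm_sqr a : l2 a -> nrm a ^+ 2 = nrm2 a.
Proof. by move=> la; rewrite sqr_sqrtr // nrm2_ge0. Qed.

Lemma nrm_ge0 a : 0 <= nrm a. Proof. exact: sqrtr_ge0. Qed.

Lemma nrm2_eq0 a : l2 a -> nrm2 a = 0 -> a = fun=> 0.
Proof.
move=> la a0; apply/funext => n; apply: sqn_eq0; apply/eqP.
rewrite eq_le sqn_ge0 andbT -a0 (le_trans _ (nrm2_partial n.+1 la)) //.
by rewrite big_ord_recr /= lerDr sumr_ge0 // => *; exact: sqn_ge0.
Qed.

Lemma nrm2Z c a : l2 a -> nrm2 (fun n => c * a n) = sqn c * nrm2 a.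
Proof.
move=> la; rewrite (_ : (fun n => _) = lin c a (fun=> 0)); last first.
  by apply/funext => n; rewrite /lin addr0.
rewrite /nrm2 ip_linl ?ip0l ?addr0 //; [|exact: l2_0|exact: l2_lin l2_0].
rewrite ip_linr //; last exact: l2_0.
rewrite ip_self // (ipC l2_0) ?ip0l //.
by case: c => x y /=; rewrite /sqn /=; ring.
Qed.

Lemma nrm2_shift k a : l2 a -> nrm2 (shift k a) = nrm2 a.
Proof. by move=> la; rewrite /nrm2 ip_shift. Qed.

Lemma nrm2_lin c a b : l2 a -> l2 b ->
  nrm2 (lin c a b) = sqn c * nrm2 a + nrm2 b + 2 * complex.Re (c * ip a b).
Proof.
move=> la lb; rewrite /nrm2 ip_linl // ?ip_linr //; last exact: l2_lin.
rewrite (ipC la lb) (ip_self la) (ip_self lb).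
case: (ip a b) => x y; case: c => s t; rewrite /sqn /=; ring.
Qed.

Lemma CauchySchwarz a b : l2 a -> l2 b -> complex.Re (ip a b) <= nrm a * nrm b.
Proof.
move=> la lb; have [a0|a0] := eqVneq (nrm2 a) 0.
  rewrite (nrm2_eq0 la a0) ip0l /=; exact: mulr_ge0 (nrm_ge0 _) (nrm_ge0 _).
have A0 : 0 < nrm2 a by rewrite lt0r a0 nrm2_ge0.
set x := complex.Re _.
have [x0|x0] := leP x 0.
  by rewrite (le_trans x0) // mulr_ge0 // nrm_ge0.
rewrite -(ler_pXn2r (ltn0Sn 1)) ?nnegrE ?(ltW x0) ?mulr_ge0 ?nrm_ge0 //.
rewrite exprMn !nrm_sqr //.
(* The coefficient is the real [c] that minimizes [||c a + b||^2]. *)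
have := nrm2_ge0 (l2_lin (Complex (- x / nrm2 a) 0) la lb).
rewrite nrm2_lin // ReM /sqn /= expr0n /= addr0 mul0r subr0 -/x => h.
have e : (- x / nrm2 a) ^+ 2 * nrm2 a = x ^+ 2 / nrm2 a.
  by rewrite exprMn sqrrN exprVn -mulrA [_^-2]invfM -!mulrA mulVf // mulr1.
have : x ^+ 2 / nrm2 a <= nrm2 b.
  have e2 : - x / nrm2 a * x = - (x ^+ 2 / nrm2 a) by field.
  by move: h; rewrite e e2; lra.
by rewrite ler_pdivrMr // mulrC.
Qed.

Lemma nrmD a b : l2 a -> l2 b -> nrm (fun n => a n + b n) <= nrm a + nrm b.
Proof.
move=> la lb; have lab := l2D la lb.
rewrite -(ler_pXn2r (ltn0Sn 1)) ?nnegrE ?addr_ge0 ?nrm_ge0 //.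
rewrite nrm_sqr // (_ : (fun n => _) = lin 1 a b); last first.
  by apply/funext => n; rewrite /lin mul1r.
rewrite nrm2_lin // mul1r sqrrD !nrm_sqr // [sqn 1](_ : _ = 1) ?mul1r; last first.
  by rewrite /sqn /= expr1n expr0n addr0.
by have := CauchySchwarz la lb; rewrite mulr2n; lra.
Qed.

Lemma nrmZ c a : l2 a -> nrm (fun n => c * a n) = cm c * nrm a.
Proof. by move=> la; rewrite /nrm nrm2Z // sqrtrM ?sqn_ge0 // cmE. Qed.

Lemma nrmB a b : l2 a -> l2 b -> nrm (fun n => a n - b n) <= nrm a + nrm b.
Proof.
move=> la lb; have := nrmD la (l2Z (-1) lb).
rewrite nrmZ // cmN cm1 mul1r; congr (nrm _ <= _).
by apply/funext => n; rewrite mulN1r.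
Qed.

Lemma trunc_approx a (e : R) : l2 a -> 0 < e ->
  exists N, nrm (fun n => a n - trunc N a n) < e.
Proof.
move=> la e0; have [N hN] := nrm2_approx la (exprn_gt0 2 e0).
exists N; rewrite -[e]ger0_norm ?(ltW e0) // -sqrtr_sqr ltr_sqrt ?exprn_gt0 //.
apply: le_lt_trans (_ : nrm2 a - \sum_(n < N) sqn (a n) < _); last by lra.
apply: nrm2_le => M; rewrite lerBrDr; apply: le_trans (nrm2_partial (maxn N M) la).
rewrite -!(big_mkord xpredT (fun n => sqn (a n))) (big_cat_nat (leq0n N) (leq_maxl N M)) /=.
rewrite [leLHS]addrC lerD2l -(big_mkord xpredT (fun n => sqn (a n - trunc N a n))).
have [NM|MN] := leqP N M; last first.
  rewrite big_nat_cond big1 ?sumr_ge0 // => [*|i /andP[/andP[_ iM] _]].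
    exact: sqn_ge0.
  by rewrite /trunc (ltn_trans iM MN) subrr sqn0.
rewrite (big_cat_nat (leq0n N) NM) /= [X in X + _]big_nat_cond [X in X + _]big1 ?add0r.
  rewrite big_nat_cond [leRHS]big_nat_cond le_eqVlt; apply/orP; left; apply/eqP.
  apply: eq_bigr => i /andP[/andP[Ni _] _].
  by rewrite /trunc ltnNge Ni subr0.
by move=> i /andP[/andP[_ iN] _]; rewrite /trunc iN subrr sqn0.
Qed.

End SquareSummable.

(** * Integration against mu *)

Section BoundedMeasurable.
Variable R : realType.
Local Notation C := (R[i]).
Implicit Types (p q : R -> R) (x y : R -> C).

Definition bm p := measurable_fun setT p /\ exists B : R, forall t, `|p t| <= B.

Lemma bm_cst (c : R) : bm (fun=> c).
Proof. by split; [exact: measurable_cst|exists `|c|]. Qed.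

Lemma bmD p q : bm p -> bm q -> bm (fun t => p t + q t).
Proof.
move=> [mp [A hA]] [mq [B hB]]; split; first exact: measurable_funD.
by exists (A + B) => t; rewrite (le_trans (ler_normD _ _)) // lerD.
Qed.

Lemma bmM p q : bm p -> bm q -> bm (fun t => p t * q t).
Proof.
move=> [mp [A hA]] [mq [B hB]]; split; first exact: measurable_funM.
by exists (A * B) => t; rewrite normrM ler_pM.
Qed.

Lemma bmZ (c : R) p : bm p -> bm (fun t => c * p t).
Proof. exact: bmM (bm_cst c). Qed.

Lemma bmN p : bm p -> bm (fun t => - p t).
Proof.
by move=> /(bmZ (-1)); congr bm; apply/funext => t; rewrite mulN1r.
Qed.

Lemma bmB p q : bm p -> bm q -> bm (fun t => p t - q t).
Proof. by move=> bp /bmN; exact: bmD. Qed.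

Lemma bm_sum (I : Type) (r : seq I) (F : I -> R -> R) :
  (forall i, bm (F i)) -> bm (fun t => \sum_(i <- r) F i t).
Proof.
move=> bF; elim: r => [|i r IH].
  by rewrite (_ : (fun t => _) = fun=> 0); [exact: bm_cst|apply/funext => t; rewrite big_nil].
rewrite (_ : (fun t => _) = fun t => F i t + \sum_(j <- r) F j t); first exact: bmD.
by apply/funext => t; rewrite big_cons.
Qed.

Lemma bmV p (d : R) : 0 < d -> bm p -> (forall t, d <= p t) -> bm (fun t => (p t)^-1).
Proof.
move=> d0 [mp _] hp; split; last first.
  exists d^-1 => t; have pt := lt_le_trans d0 (hp t).
  by rewrite gtr0_norm ?invr_gt0 // lef_pV2.
(* Capping from below at [d] does not change the values of [p] and makes the reciprocal continuous
   on the whole line, hence measurable. *)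
rewrite (_ : (fun t => _) = (fun s : R => (Num.max s d)^-1) \o p); last first.
  by apply/funext => t /=; rewrite max_l.
apply: measurableT_comp => //; apply: continuous_measurable_fun => s.
apply: cvgV; first by rewrite gt_eqF // lt_max d0 orbT.
by apply: (@continuous_max _ _ idfun (cst d)); [exact: cvg_id|exact: cvg_cst].
Qed.

Lemma bm_indic (A : set R) : measurable A -> bm (\1_A : R -> R).
Proof.
move=> mA; split; first exact: measurable_indic.
by exists 1 => t; rewrite indicE; case: (_ \in _); rewrite ?normr1 ?normr0.
Qed.

Definition cbm x := bm (fun t => complex.Re (x t)) /\ bm (fun t => complex.Im (x t)).

Lemma cbm_cst (c : C) : cbm (fun=> c).
Proof. by split; exact: bm_cst. Qed.

Lemma cbmD x y : cbm x -> cbm y -> cbm (fun t => x t + y t).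
Proof.
move=> [rx ix] [ry iy]; split.
  by have := bmD rx ry; congr bm; apply/funext => t; rewrite ReD.
by have := bmD ix iy; congr bm; apply/funext => t; rewrite ImD.
Qed.

Lemma cbmM x y : cbm x -> cbm y -> cbm (fun t => x t * y t).
Proof.
move=> [rx ix] [ry iy]; split.
  by have := bmB (bmM rx ry) (bmM ix iy); congr bm; apply/funext => t; rewrite ReM.
by have := bmD (bmM rx iy) (bmM ix ry); congr bm; apply/funext => t; rewrite ImM.
Qed.

Lemma cbmZ (c : C) x : cbm x -> cbm (fun t => c * x t).
Proof. exact: cbmM (cbm_cst c). Qed.

Lemma cbmJ x : cbm x -> cbm (fun t => conjc (x t)).
Proof.
move=> [rx ix]; split.
  by move: rx; congr bm; apply/funext => t; rewrite ReJ.
by have := bmN ix; congr bm; apply/funext => t; rewrite ImJ.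
Qed.

Lemma cbmX x n : cbm x -> cbm (fun t => x t ^+ n).
Proof.
move=> bx; elim: n => [|n IH]; first exact: cbm_cst.
by have := cbmM bx IH; congr cbm; apply/funext => t; rewrite exprS.
Qed.

Lemma cbm_sum (I : Type) (r : seq I) (F : I -> R -> C) :
  (forall i, cbm (F i)) -> cbm (fun t => \sum_(i <- r) F i t).
Proof.
move=> bF; split.
  have := bm_sum r (fun i => proj1 (bF i)).
  by congr bm; apply/funext => t; rewrite Re_sum.
have := bm_sum r (fun i => proj2 (bF i)).
by congr bm; apply/funext => t; rewrite Im_sum.
Qed.

Lemma bm_sqn x : cbm x -> bm (fun t => sqn (x t)).
Proof. by move=> [rx ix]; apply: bmD; apply: bmM. Qed.

Lemma cbmV x (d : R) : 0 < d -> cbm x -> (forall t, d <= sqn (x t)) ->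
  cbm (fun t => (x t)^-1).
Proof.
move=> d0 bx hd; have bV := bmV d0 (bm_sqn bx) hd; case: bx => rx ix; split.
  by have := bmM rx bV; congr bm; apply/funext => t; case: (x t).
by have := bmN (bmM ix bV); congr bm; apply/funext => t; case: (x t).
Qed.

Lemma cbm_expi : cbm (@expi R).
Proof.
split; split => /=.
- by apply: continuous_measurable_fun; exact: continuous_cos.
- by exists 1 => t; rewrite ler_norml cos_geN1 cos_le1.
- by apply: continuous_measurable_fun; exact: continuous_sin.
- by exists 1 => t; rewrite ler_norml sin_geN1 sin_le1.
Qed.

Lemma sqn_expi (t : R) : sqn (expi t) = 1.
Proof. by rewrite /sqn /= cos2Dsin2. Qed.

Lemma cm_expi (t : R) : cm (expi t) = 1.
Proof. by rewrite cmE sqn_expi sqrtr1. Qed.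

Lemma expi_mulJ (t : R) : expi t * conjc (expi t) = 1.
Proof. by rewrite mulcJ sqn_expi. Qed.

Lemma expiX (t : R) n : expi t ^+ n = expi (n%:R * t).
Proof.
elim: n => [|n IH]; first by rewrite expr0 mul0r /expi cos0 sin0.
rewrite exprS IH -natr1 mulrDl mul1r addrC /expi cosD sinD.
by simpc; congr Complex; ring.
Qed.

End BoundedMeasurable.

Section Expectation.
Variables (R : realType) (mu : {measure set R -> \bar R}).
Hypothesis mu1 : mu setT = 1%E.
Local Notation C := (R[i]).
Implicit Types (p q : R -> R) (x y : R -> C).

Definition Ex p : R := Rintegral mu setT p.

Lemma bm_integrable p : bm p -> mu.-integrable setT (EFin \o p).
Proof.
move=> [mp [B hB]]; apply: measurable_bounded_integrable => //.
  by rewrite mu1 ltry.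
exists B; split; first exact: num_real.
by move=> M BM t _ /=; rewrite (le_trans (hB t)) // ltW.
Qed.

Lemma ExD p q : bm p -> bm q -> Ex (fun t => p t + q t) = Ex p + Ex q.
Proof. by move=> bp bq; apply: RintegralD => //; exact: bm_integrable. Qed.

Lemma ExZ (c : R) p : bm p -> Ex (fun t => c * p t) = c * Ex p.
Proof. by move=> bp; apply: RintegralZl => //; exact: bm_integrable. Qed.

Lemma Ex_le p q : bm p -> bm q -> (forall t, p t <= q t) -> Ex p <= Ex q.
Proof. by move=> bp bq h; apply: le_Rintegral => //; exact: bm_integrable. Qed.

Lemma Ex_cst (c : R) : Ex (fun=> c) = c.
Proof. by rewrite /Ex Rintegral_cst // mu1 /= mulr1. Qed.

Lemma Ex_ge0 p : (forall t, 0 <= p t) -> 0 <= Ex p.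
Proof. by move=> h; apply: Rintegral_ge0. Qed.

Lemma Ex_sum (I : Type) (r : seq I) (F : I -> R -> R) : (forall i, bm (F i)) ->
  Ex (fun t => \sum_(i <- r) F i t) = \sum_(i <- r) Ex (F i).
Proof.
move=> bF; elim: r => [|i r IH].
  rewrite (_ : (fun t => _) = fun=> 0); first by rewrite Ex_cst big_nil.
  by apply/funext => t; rewrite big_nil.
rewrite big_cons -IH -ExD //; last exact: bm_sum.
by congr Ex; apply/funext => t; rewrite big_cons.
Qed.

Lemma Ex_indic (A : set R) : measurable A -> Ex (\1_A) = fine (mu A).
Proof. by move=> mA; rewrite /Ex /Rintegral integral_indic // setIT. Qed.

Local Notation CE := (Cint mu).

Lemma CE_ReE x : complex.Re (CE x) = Ex (fun t => complex.Re (x t)). Proof. by []. Qed.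
Lemma CE_ImE x : complex.Im (CE x) = Ex (fun t => complex.Im (x t)). Proof. by []. Qed.

Lemma CE_cst (c : C) : CE (fun=> c) = c.
Proof. by apply: complexP; rewrite ?CE_ReE ?CE_ImE Ex_cst. Qed.

Lemma CED x y : cbm x -> cbm y -> CE (fun t => x t + y t) = CE x + CE y.
Proof.
move=> [rx ix] [ry iy]; apply: complexP.
  rewrite ReD !CE_ReE -ExD //; congr Ex; apply/funext => t; exact: ReD.
rewrite ImD !CE_ImE -ExD //; congr Ex; apply/funext => t; exact: ImD.
Qed.

Lemma CEZ (c : C) x : cbm x -> CE (fun t => c * x t) = c * CE x.
Proof.
move=> [rx ix]; apply: complexP.
  rewrite ReM !CE_ReE CE_ImE -mulNr -!ExZ // -ExD; try exact: bmZ.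
  by congr Ex; apply/funext => t; rewrite ReM mulNr.
rewrite ImM !CE_ImE CE_ReE -!ExZ // -ExD; try exact: bmZ.
by congr Ex; apply/funext => t; rewrite ImM.
Qed.

Lemma CE_sum (I : Type) (r : seq I) (c : I -> C) (F : I -> R -> C) :
  (forall i, cbm (F i)) ->
  CE (fun t => \sum_(i <- r) c i * F i t) = \sum_(i <- r) c i * CE (F i).
Proof.
move=> bF; elim: r => [|i r IH].
  rewrite (_ : (fun t => _) = fun=> 0); first by rewrite CE_cst big_nil.
  by apply/funext => t; rewrite big_nil.
rewrite big_cons -IH -CEZ // -CED; [|exact: cbmZ|by apply: cbm_sum => j; exact: cbmZ].
by congr CE; apply/funext => t; rewrite big_cons.
Qed.

Lemma CEJ x : cbm x -> CE (fun t => conjc (x t)) = conjc (CE x).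
Proof.
move=> [rx ix]; apply: complexP.
  by rewrite ReJ !CE_ReE; congr Ex; apply/funext => t; rewrite ReJ.
rewrite ImJ !CE_ImE -mulN1r -ExZ //; congr Ex; apply/funext => t.
by rewrite ImJ mulN1r.
Qed.

(** The factor 2 comes from treating real and imaginary parts separately; it is harmless in the
    geometric error bounds. *)
Lemma cm_CE_le x (B : R) : cbm x -> (forall t, cm (x t) <= B) -> cm (CE x) <= B + B.
Proof.
move=> [rx ix] hB; apply: le_trans (cm_le _) _.
have aux p : bm p -> (forall t, `|p t| <= B) -> `|Ex p| <= B.
  move=> bp h; rewrite ler_norml; apply/andP; split.
    rewrite -[leLHS]Ex_cst; apply: Ex_le => //; first exact: bm_cst.
    by move=> t; have := h t; rewrite ler_norml => /andP[].
  rewrite -[leRHS]Ex_cst; apply: Ex_le => //; first exact: bm_cst.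
  by move=> t; have := h t; rewrite ler_norml => /andP[].
by rewrite lerD // aux // => t; rewrite (le_trans _ (hB t)) ?Re_le_cm ?Im_le_cm.
Qed.

End Expectation.

(** * Taylor coefficients of theta *)

Section ConvInverse.
Variable R : realType.
Local Notation C := (R[i]).

Lemma conjcM (x y : C) : conjc (x * y) = conjc x * conjc y.
Proof. exact: rmorphM. Qed.
Lemma conjcX (x : C) n : conjc (x ^+ n) = conjc x ^+ n.
Proof. exact: rmorphXn. Qed.
Lemma conjc_sum (I : Type) (r : seq I) (F : I -> C) :
  conjc (\sum_(i <- r) F i) = \sum_(i <- r) conjc (F i).
Proof. exact: rmorph_sum. Qed.

(** Formal inverse of a power series with constant term 1. Each new coefficient depends on all
    earlier ones, so the recursion carries the list of those already found. *)
Lemma conv_inverse (a : nat -> C) : a 0%N = 1 ->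
  exists e : nat -> C, conv e a =1 delta R 0.
Proof.
move=> a0.
pose next (s : seq C) := - \sum_(k < size s) nth 0 s k * a (size s - k)%N.
pose es := fix es n : seq C :=
  if n is n'.+1 then rcons (es n') (next (es n')) else [:: 1].
have ses n : size (es n) = n.+1 by elim: n => //= n IH; rewrite size_rcons IH.
pose e n := nth 0 (es n) n.
have eE n k : (k <= n)%N -> nth 0 (es n) k = e k.
  elim: n => [|n IH]; first by rewrite leqn0 => /eqP ->.
  rewrite leq_eqVlt => /orP[/eqP -> //|kn]; rewrite /= nth_rcons ses kn.
  exact: IH.
exists e => -[|n]; rewrite /conv /delta.
  by rewrite big_ord_recl big_ord0 addr0 a0 mulr1.
rewrite big_ord_recr /= subnn a0 mulr1 [e n.+1]/e /= nth_rcons ses ltnn eqxx /next ses.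
apply/eqP; rewrite subr_eq0; apply/eqP; apply: eq_bigr => i _.
by rewrite eE // -ltnS.
Qed.

Lemma taylor_fun_uniq (a : nat -> C) f h : is_taylor a f -> is_taylor a h -> f = h.
Proof.
by move=> /is_taylorP af /is_taylorP ah; apply/funext => z; exact: ccvg_uniq (af z) (ah z).
Qed.

End ConvInverse.

Section Clark.
Variables (R : realType) (mu : {measure set R -> \bar R}).
Hypothesis mu1 : mu setT = 1%E.
Local Notation C := (R[i]).
Local Notation CE := (Cint mu).
Local Notation Z := (@expi R).

(** The Fourier coefficient of [mu] at [k - j]; two natural indices avoid signed exponents. The
    sequence [mom 0] consists of the Taylor coefficients of [1 / (1 - theta)]. *)
Definition mom (j k : nat) : C := CE (fun t => Z t ^+ j * conjc (Z t) ^+ k).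

Lemma cbm_mono j k : cbm (fun t => Z t ^+ j * conjc (Z t) ^+ k).
Proof.
by apply: cbmM; apply: cbmX; [exact: cbm_expi|exact: (cbmJ (@cbm_expi R))].
Qed.

Lemma momD i j k : mom (i + j) (i + k) = mom j k.
Proof.
congr CE; apply/funext => t; rewrite !exprD.
rewrite (_ : _ * _ * _ = (Z t * conjc (Z t)) ^+ i * (Z t ^+ j * conjc (Z t) ^+ k)).
  by rewrite expi_mulJ expr1n mul1r.
by rewrite exprMn; ring.
Qed.

Lemma momJ j k : conjc (mom j k) = mom k j.
Proof.
rewrite -CEJ //; last exact: cbm_mono.
by congr CE; apply/funext => t; rewrite conjcM !conjcX conjcK mulrC.
Qed.

Lemma mom00 : mom 0 0 = 1.
Proof.
rewrite -[RHS](CE_cst mu1); congr CE; apply/funext => t.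
by rewrite !expr0 mulr1.
Qed.

Lemma mom_le j k : (j <= k)%N -> mom j k = mom 0 (k - j).
Proof. by move=> jk; rewrite -{1}(addn0 j) -{1}(subnKC jk) momD. Qed.

Definition cker (z : C) (t : R) : C := (1 - z * conjc (Z t))^-1.

Lemma cm_zJ z t : cm (z * conjc (Z t)) = cm z.
Proof. by rewrite cmM cmJ cm_expi mulr1. Qed.

Lemma cm_1B (z : C) : 1 - cm z <= cm (1 - z).
Proof. by rewrite lerBlDr -{1}(@cm1 R) -{1}(subrK z 1) cmD. Qed.

Lemma one_sub_neq0 (z : C) : cm z < 1 -> 1 - z != 0.
Proof.
move=> z1; apply/eqP => h; have := cm_1B z.
by rewrite h cm0; lra.
Qed.

Lemma geo_kernel (w : C) N : 1 - w != 0 ->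
  \sum_(i < N) w ^+ i - (1 - w)^-1 = - (w ^+ N * (1 - w)^-1).
Proof.
move=> w1; apply: (mulIf w1); rewrite mulrBl mulNr -mulrA mulVf // mulr1.
by rewrite -[1 - w]opprB mulrN mulrC -subrX1 opprB addrAC subrr add0r.
Qed.

Lemma cbm_cker z : cm z < 1 -> cbm (cker z).
Proof.
move=> z1; apply: (@cbmV _ _ ((1 - cm z) ^+ 2)).
- by rewrite exprn_gt0 // subr_gt0.
- have := cbmD (cbm_cst 1) (cbmZ (- z) (cbmJ (@cbm_expi R))).
  by congr cbm; apply/funext => t; rewrite mulNr.
move=> t; rewrite -cm_sqr lerXn2r ?nnegrE ?cm_ge0 ?subr_ge0 ?(ltW z1) //.
by rewrite -{1}(cm_zJ z t) cm_1B.
Qed.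

(** The geometric sum has the explicit remainder of [geo_kernel], which is at most [B r^N / (1 - r)]
    in modulus uniformly in [t]. Sum and integral are therefore exchanged without a limit
    theorem. *)
Lemma cauchy_cvg (y : R -> C) (z : C) : cbm y -> cm z < 1 ->
  ccvg (psum (fun n => CE (fun t => y t * conjc (Z t) ^+ n) * z ^+ n))
       (CE (fun t => y t / (1 - z * conjc (Z t)))).
Proof.
move=> by_ z1.
have cJ n : cbm (fun t => y t * conjc (Z t) ^+ n).
  by apply: cbmM => //; apply: cbmX; exact: (cbmJ (@cbm_expi R)).
have ck : cbm (fun t => y t * cker z t) by exact: (cbmM by_ (cbm_cker z1)).
have [B hB] : exists B : R, forall t, cm (y t) <= B.
  case: (by_) => [[_ [A hA]] [_ [B hB]]]; exists (A + B) => t.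
  by rewrite (le_trans (cm_le _)) // lerD.
pose r := cm z.
have r0 : 0 <= r by exact: cm_ge0.
apply: (@ccvg_geo _ _ _ (B / (1 - r) + B / (1 - r)) r); first by rewrite r0.
move=> N; rewrite /psum.
under eq_bigr do rewrite mulrC.
rewrite -(CE_sum mu1) // -[X in _ - X]mul1r -mulNr -(CEZ mu1) // -(CED mu1); first last.
- exact: cbmZ.
- by apply: cbm_sum => n; exact: cbmZ.
rewrite mulrDl; apply: (cm_CE_le mu1).
  by apply: cbmD; [apply: cbm_sum => n; exact: cbmZ|exact: cbmZ].
move=> t.
have w1 : 1 - z * conjc (Z t) != 0 by rewrite one_sub_neq0 // cm_zJ.
rewrite (_ : _ + _ = - (y t * (z * conjc (Z t)) ^+ N * cker z t)).
  rewrite cmN !cmM cmX cm_zJ -/r mulrAC ler_wpM2r ?exprn_ge0 //.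
  rewrite /cker cmV ler_pM ?cm_ge0 ?invr_ge0 ?cm_ge0 //.
  rewrite lef_pV2 ?posrE ?subr_gt0 ?cm_gt0 //.
  by have := cm_1B (z * conjc (Z t)); rewrite cm_zJ.
rewrite (_ : \sum_(i < N) _ = y t * \sum_(i < N) (z * conjc (Z t)) ^+ i).
  by rewrite mulN1r -mulrBr geo_kernel // mulrN mulrA.
by rewrite mulr_sumr; apply: eq_bigr => i _; rewrite exprMn mulrCA.
Qed.

Lemma cauchy_taylor (y : R -> C) : cbm y ->
  is_taylor (fun n => CE (fun t => y t * conjc (Z t) ^+ n))
            (fun z => CE (fun t => y t / (1 - val z * conjc (Z t)))).
Proof. by move=> cy; apply/is_taylorP => z; exact: cauchy_cvg cy (disk_lt1 z). Qed.

Definition Hz (z : C) : C := CE (cker z).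

Lemma Hz_taylor : is_taylor (mom 0) (fun z => Hz (val z)).
Proof.
have := cauchy_taylor (cbm_cst 1); congr is_taylor.
by apply/funext => z; congr CE; apply/funext => t; rewrite mul1r.
Qed.

Lemma exists_ecoef : exists e : nat -> C, conv e (mom 0) =1 delta R 0.
Proof. exact: conv_inverse mom00. Qed.

(** The coefficients of [1 - theta], obtained as a formal inverse before anything is known about
    convergence. *)
Definition ecoef : nat -> C := projT1 (cid exists_ecoef).
Definition thc (n : nat) : C := delta R 0 n - ecoef n.

Lemma ecoefP n : conv ecoef (mom 0) n = delta R 0 n.
Proof. exact: (projT2 (cid exists_ecoef)). Qed.

Lemma ecoef0 : ecoef 0 = 1.
Proof. by have := ecoefP 0; rewrite /conv big_ord1 mom00 mulr1. Qed.

Lemma thc0 : thc 0 = 0. Proof. by rewrite /thc ecoef0 subrr. Qed.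

Lemma ecoef_mom n : (0 < n)%N -> \sum_(k < n) ecoef k * mom k n = - ecoef n.
Proof.
move=> n0; have := ecoefP n; rewrite /conv big_ord_recr /= subnn mom00 mulr1.
rewrite /delta (_ : (n == 0)%N = false); last by lia.
move=> /eqP; rewrite addr_eq0 => /eqP <-; apply: eq_bigr => i _.
by rewrite mom_le // ltnW.
Qed.

(** The left side is the integral of [|sum_(k <= N) e_k Z^k|^2] against [mu]. Passing to [N + 1]
    adds two cross terms, each equal to [- |e_(N+1)|^2] by [ecoef_mom], and the diagonal term
    [|e_(N+1)|^2]. *)
Lemma bessel_sum N : 
  \sum_(k < N.+1) \sum_(l < N.+1) ecoef k * conjc (ecoef l) * mom k l
   = 1 - \sum_(k < N.+1) thc k * conjc (thc k).
Proof.
elim: N => [|N IH].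
  by rewrite !big_ord1 ecoef0 thc0 mul0r subr0 rmorph1 mom00 !mulr1.
rewrite big_ord_recr /=.
under eq_bigr do rewrite big_ord_recr /=.
rewrite big_split /= IH [\sum_(l < N.+2) _]big_ord_recr /=.
have h := @ecoef_mom N.+1 isT.
have -> : \sum_(i < N.+1) ecoef i * conjc (ecoef N.+1) * mom i N.+1
    = - ecoef N.+1 * conjc (ecoef N.+1).
  by rewrite -h mulr_suml; apply: eq_bigr => i _; ring.
have -> : \sum_(i < N.+1) ecoef N.+1 * conjc (ecoef i) * mom N.+1 i
    = - ecoef N.+1 * conjc (ecoef N.+1).
  rewrite mulNr -mulrN -rmorphN /= -h conjc_sum mulr_sumr; apply: eq_bigr => i _.
  by rewrite conjcM momJ mulrA.
rewrite [in RHS]big_ord_recr /= -[in mom N.+1 N.+1](addn0 N.+1) momD mom00.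
by rewrite /thc /delta /= sub0r rmorphN; ring.
Qed.

(** Nonnegativity of the integral in [bessel_sum]. This bounds the coefficients of [theta] without
    any function theory. *)
Lemma thc_bessel N : \sum_(k < N) sqn (thc k) <= 1.
Proof.
case: N => [|N]; first by rewrite big_ord0.
pose S t := \sum_(k < N.+1) ecoef k * Z t ^+ k.
have := Ex_ge0 mu (fun t => sqn_ge0 (S t)).
have cS : cbm (fun t => S t * conjc (S t)).
  suff h : cbm S by apply: cbmM => //; exact: cbmJ.
  by apply: cbm_sum => k; apply: cbmZ; apply: cbmX; exact: cbm_expi.
have -> : Ex mu (fun t => sqn (S t)) = complex.Re (CE (fun t => S t * conjc (S t))).
  by rewrite CE_ReE; congr Ex; apply/funext => t; rewrite mulcJ.
have -> : CE (fun t => S t * conjc (S t)) =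
    \sum_(k < N.+1) \sum_(l < N.+1) ecoef k * conjc (ecoef l) * mom k l.
  transitivity (CE (fun t => \sum_(p : 'I_N.+1 * 'I_N.+1)
      (ecoef p.1 * conjc (ecoef p.2)) * (Z t ^+ p.1 * conjc (Z t) ^+ p.2))).
    congr CE; apply/funext => t; rewrite /S conjc_sum big_distrlr /=.
    rewrite pair_bigA /=; apply: eq_bigr => -[k l] _ /=.
    by rewrite conjcM conjcX mulrACA.
  by rewrite (CE_sum mu1) => [|p]; [rewrite pair_bigA|exact: cbm_mono].
rewrite bessel_sum ReD ReN Re_sum.
under eq_bigr do rewrite mulcJ /=.
by rewrite /= subr_ge0.
Qed.

Lemma thc_l2 : l2 thc.
Proof. by exists 1; exact: thc_bessel. Qed.

Lemma cm_thc_le1 n : cm (thc n) <= 1.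
Proof.
rewrite -(ler_pXn2r (ltn0Sn 1)) ?nnegrE ?cm_ge0 // expr1n cm_sqr.
rewrite (le_trans _ (thc_bessel n.+1)) // big_ord_recr /= lerDr sumr_ge0 // => *.
exact: sqn_ge0.
Qed.

Lemma ecoefE n : ecoef n = delta R 0 n - thc n.
Proof. by rewrite /thc opprB addrC subrK. Qed.

(** The bound on the coefficients gives the formal inverse a sum [E] on the disk. The Cauchy product
    yields [E H = 1] with [H] the Cauchy transform of [mu], so [H] has no zero and [E = 1 / H]. *)
Lemma ecoef_taylor : is_taylor ecoef (fun z => 1 - clark_theta mu z).
Proof.
have te : tame ecoef.
  apply: (@tame_bounded _ _ 2) => n; rewrite ecoefE (le_trans (cmB _ _)) //.
  have -> : 2 = 1 + 1 :> R by [].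
  rewrite lerD ?cm_thc_le1 // /delta; case: eqP => _; rewrite ?cm1 ?cm0 //.
pose E (z : disk R) := projT1 (cid (tame_geo te (disk_lt1 z))).
have tE : is_taylor ecoef E.
  by apply/is_taylorP => z; exact: (projT2 (cid (tame_geo te (disk_lt1 z)))).
have := taylor_mul tE Hz_taylor; rewrite (funext ecoefP) => tEH.
have EH := taylor_fun_uniq tEH (@taylor_delta R 0).
rewrite (_ : (fun z => _) = E) //; apply/funext => z.
have /(congr1 (fun f => f z)) := EH; rewrite expr0 => {}EH.
have H0 : Hz (val z) != 0.
  by apply/eqP => h; move: EH; rewrite h mulr0 => /esym/eqP; rewrite oner_eq0.
have -> : 1 - clark_theta mu z = (Hz (val z))^-1.
  by rewrite /clark_theta opprB addrC subrK.
by apply: (mulIf H0); rewrite mulVf // EH.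
Qed.

Lemma thc_taylor : is_taylor thc (clark_theta mu).
Proof.
have := taylor_lin (-1) ecoef_taylor (@taylor_delta R 0); congr is_taylor.
  by apply/funext => n; rewrite /thc mulN1r addrC.
by apply/funext => z; rewrite expr0; ring.
Qed.

Lemma conv_thc_mom n : conv thc (mom 0) n = mom 0 n - delta R 0 n.
Proof.
rewrite -ecoefP /conv /thc; under eq_bigr do rewrite mulrBl.
rewrite sumrB -[X in X - _]/(conv (delta R 0) (mom 0) n) conv_delta.
by rewrite /shift ltn0 subn0.
Qed.

Lemma Jinv_taylor (y : R -> C) : cbm y ->
  is_taylor (conv ecoef (fun n => CE (fun t => y t * conjc (Z t) ^+ n)))
            (clarkJinv mu y).
Proof. by move=> cy; apply: taylor_mul; [exact: ecoef_taylor|exact: cauchy_taylor]. Qed.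

End Clark.

(** * Covering a singular measure *)

Section Cover.
Variable R : realType.
Variable mu : {measure set R -> \bar R}.

Lemma lebesgue_null_cover (N : set R) (e : R) : (@lebesgue_measure R) N = 0%E -> 0 < e ->
  exists ab : nat -> R * R, [/\ forall k, (ab k).1 <= (ab k).2,
    N `<=` \bigcup_k (`](ab k).1, (ab k).2]%classic) &
    forall n, \sum_(k < n) ((ab k).2 - (ab k).1) <= e].
Proof.
move=> N0 e0.
have /ereal_inf_lt[_ [/= A covA <-] Ae] : ((@lebesgue_measure R) N < e%:E)%E.
  by rewrite N0 lte_fin.
have hA k : exists ab : R * R, [/\ ab.1 <= ab.2, A k `<=` `]ab.1, ab.2]%classic &
    ((ab.2 - ab.1)%:E <= wlength idfun (A k))%E].
  have /ocitvP[->|[[a b] /= ab ->]] : ocitv (A k) by case: covA => /(_ k).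
    by exists (0, 0); split => //=; rewrite subrr wlength0.
  exists (a, b); split => //=; first exact: ltW.
  by rewrite wlength_itv /= lte_fin ab -EFinD.
pose ab k := projT1 (cid (hA k)).
have abP k : [/\ (ab k).1 <= (ab k).2, A k `<=` `](ab k).1, (ab k).2]%classic &
    (((ab k).2 - (ab k).1)%:E <= wlength idfun (A k))%E] by exact: (projT2 (cid (hA k))).
exists ab; split.
- by move=> k; case: (abP k).
- case: covA => _ NA x /NA[k _ Akx]; exists k => //.
  by case: (abP k) => _ + _; apply.
move=> n; rewrite -lee_fin; apply: le_trans (ltW Ae).
rewrite -sumEFin; apply: (@le_trans _ _ (\sum_(0 <= k < n) wlength idfun (A k))%E).
  by rewrite big_mkord; apply: lee_sum => k _; case: (abP k).
apply: nneseries_lim_ge => k _ _; exact: wlength_ge0.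
Qed.

(** A null set carrying [mu] is covered by countably many intervals of total length at most [e]. The
    complements of the finite unions, taken within [T], decrease to a [mu]-null set, so finitely
    many intervals already carry all but [e] of the mass. *)
Lemma singular_cover (N T : set R) (e : R) : mu setT = 1%E ->
  measurable T -> mu (~` T) = 0%E ->
  measurable N -> (@lebesgue_measure R) N = 0%E -> mu (~` N) = 0%E -> 0 < e ->
  exists (I : seq (R * R)) (K : set R),
    [/\ all (fun ab => ab.1 <= ab.2) I, \sum_(ab <- I) (ab.2 - ab.1) <= e,
       measurable K /\ K `<=` T, (mu (~` K) <= e%:E)%E &
       forall t, K t -> has (fun ab => ab.1 < t <= ab.2) I].
Proof.
move=> mu1 mT muT mN N0 muN e0.
have [ab [ab0 NI sI]] := lebesgue_null_cover N0 e0.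
pose A k : set R := `](ab k).1, (ab k).2]%classic.
have mA k : measurable (A k) by exact: measurable_itv.
pose K n : set R := (\bigcup_(k in [set k | (k < n)%N]) A k) `&` T.
have mK n : measurable (K n).
  by apply: measurableI => //; apply: bigcup_measurable => k _; exact: mA.
have KK : {homo (fun n => ~` K n) : n m / (n <= m)%N >-> (m <= n)%O}.
  move=> n m nm; rewrite subsetEset; apply: subsetC => t [[k /= kn At] Tt].
  by split=> //; exists k => //=; exact: leq_trans kn nm.
have cap0 : mu (\bigcap_n ~` K n) = 0%E.
  apply/eqP; rewrite eq_le measure_ge0 andbT.
  have mm : measurable (\bigcap_n ~` K n).
    by apply: bigcap_measurable => // k _; exact: measurableC.
  apply: (@le_trans _ _ (mu (~` N `|` ~` T))).
    apply: le_measure; rewrite ?inE //.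
      by apply: measurableU; exact: measurableC.
    move=> t h; apply: contrapT => /not_orP[] /contrapT Nt /contrapT Tt.
    have [k _ Ak] := NI _ Nt.
    by have := h k.+1 I; apply; split => //; exists k => //=.
  apply: (@le_trans _ _ (mu (~` N) + mu (~` T))%E); last by rewrite muN muT adde0.
  by apply: measureU2; exact: measurableC.
have cv : (mu \o (fun n => ~` K n)) x @[x --> \oo] --> 0%E.
  rewrite -cap0; apply: nonincreasing_cvg_mu => //.
  - rewrite (@le_lt_trans _ _ (mu setT)) ?mu1 ?ltry // -mu1.
    by apply: le_measure; rewrite ?inE //; exact: measurableC.
  - by move=> i; exact: measurableC.
  - by apply: bigcap_measurable => // k _; exact: measurableC.
have [n hn] : exists n, (mu (~` K n) < e%:E)%E.
  have /cv : nbhs (0%E : \bar R) [set x : \bar R | (x < e%:E)%E].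
    by apply: open_nbhs_nbhs; split; [exact: open_ereal_lt_ereal|rewrite /= lte_fin].
  by move=> [n _ hn]; exists n; apply: (hn n) => /=.
exists [seq ab k | k <- iota 0 n], (K n); split.
- by rewrite all_map; apply/allP => k _ /=.
- rewrite big_map; have := sI n.
  by rewrite -(big_mkord xpredT (fun k => (ab k).2 - (ab k).1)) /index_iota subn0.
- by split => // t [].
- exact: ltW.
move=> t [[k /= kn] At _]; apply/hasP; exists (ab k).
  by apply: map_f; rewrite mem_iota.
by move: At; rewrite /A /= in_itv.
Qed.

End Cover.

(** * Separation from 1 of the cosine *)

Section Trig.
Variable R : realType.
Implicit Types (x y d : R).

Lemma cos_sep d x : 0 <= d <= pi -> d <= `|x| <= 2 * pi - d -> cos x <= cos d.
Proof.
wlog x0 : x / 0 <= x => [hw dd xx|].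
  have [x0|x0] := leP 0 x; first exact: hw.
  by rewrite -cosN; apply: hw => //; [rewrite oppr_ge0 ltW|rewrite normrN].
rewrite ger0_norm // => /andP[d0 dpi] /andP[dx xd].
have mono y : d <= y <= pi -> cos y <= cos d.
  move=> /andP[dy ypi]; rewrite leNgt ltr_cos ?in_itv /= ?d0 ?dpi ?ypi ?andbT //.
    by rewrite -leNgt.
  exact: le_trans d0 dy.
have [xpi|xpi] := leP x pi; first by apply: mono; rewrite dx.
rewrite -cosN -(cosD2pi (- x)); apply: mono.
by rewrite mulr2n; lra.
Qed.

Lemma cos_lt1 x : 0 < x < 2 * pi -> cos x < 1.
Proof.
move=> /andP[x0 x2]; have p0 := pi_gt0 R.
have [h|h] := leP x pi.
  by rewrite -cos0 ltr_cos // in_itv /= ?lexx ?(ltW p0) ?h ?(ltW x0).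
have h' : cos (2 * pi - x) < cos 0.
  by rewrite ltr_cos ?in_itv /=; lra.
move: h'; rewrite cos0 (_ : 2 * pi - x = - x + pi *+ 2) ?cosD2pi ?cosN //.
by rewrite mulr2n; ring.
Qed.

End Trig.

(** * Means over roots of unity *)

Section RootsOfUnity.
Variable R : realType.
Local Notation C := (R[i]).

Definition omg (M : nat) : C := expi (2 * pi / M%:R).

Lemma cm_omg M : cm (omg M) = 1. Proof. exact: cm_expi. Qed.

Lemma omg_M M : (0 < M)%N -> omg M ^+ M = 1.
Proof.
move=> M0; rewrite /omg expiX mulrC mulfVK; last by rewrite pnatr_eq0 -lt0n.
by rewrite /expi mulrC mulr_natr cos2pi sin2pi.
Qed.

Lemma omgX_neq1 M k : (0 < k < M)%N -> omg M ^+ k != 1.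
Proof.
move=> /andP[k0 kM]; have p0 := pi_gt0 R.
have M0 : 0 < M%:R :> R by rewrite ltr0n; lia.
have hk : 0 < k%:R :> R by rewrite ltr0n.
have hkM : k%:R < M%:R :> R by rewrite ltr_nat.
rewrite /omg expiX; apply/eqP => -[h _]; move: h; apply/eqP; rewrite lt_eqF //.
apply: cos_lt1; rewrite mulrA; apply/andP; split.
  by rewrite divr_gt0 // mulr_gt0 // mulr_gt0.
by rewrite ltr_pdivrMr // mulrC ltr_pM2l // mulr_gt0.
Qed.

Lemma sum_root0 (x : C) M : x ^+ M = 1 -> x != 1 -> \sum_(j < M) x ^+ j = 0.
Proof.
move=> xM x1; apply: (@mulfI _ (x - 1)); first by rewrite subr_eq0.
by rewrite -subrX1 xM subrr mulr0.
Qed.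

Lemma root_orth M (k l : 'I_M) :
  \sum_(j < M) (omg M ^+ k * conjc (omg M ^+ l)) ^+ j = (k == l)%:R * M%:R.
Proof.
have M0 : (0 < M)%N by case: M k {l} => [[]|].
have e1 : omg M * conjc (omg M) = 1 by exact: expi_mulJ.
have [->|kl] := eqVneq k l.
  rewrite mul1r (eq_bigr (fun=> 1)) ?sumr_const ?card_ord // => j _.
  by rewrite conjcX -exprMn e1 !expr1n.
rewrite mul0r; apply: sum_root0.
  rewrite exprMn conjcX -!exprM ![(_ * M)%N]mulnC !exprM -conjcX omg_M // conjc1.
  by rewrite !expr1n mulr1.
have [kl'|lk] := ltnP k l.
  rewrite -(subnK (ltnW kl')) exprD conjcM mulrCA [conjc (_ ^+ k)]conjcX -exprMn e1 expr1n mulr1.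
  apply/eqP => /(congr1 conjc); rewrite conjcK conjc1; apply/eqP.
  apply: omgX_neq1; have := ltn_ord l; lia.
have {lk kl} lk : (l < k)%N by rewrite ltn_neqAle lk andbT eq_sym.
rewrite -(subnK (ltnW lk)) exprD -mulrA conjcX -exprMn e1 expr1n mulr1.
by apply: omgX_neq1; have := ltn_ord k; lia.
Qed.

Lemma parseval_roots M (b : nat -> C) :
  \sum_(j < M) sqn (\sum_(n < M) b n * (omg M ^+ j) ^+ n) =
  M%:R * \sum_(n < M) sqn (b n).
Proof.
apply: (@complexI R); rewrite rmorph_sum rmorphM rmorph_nat rmorph_sum /=.
transitivity (\sum_(j < M) \sum_(n < M) \sum_(l < M)
   (b n * conjc (b l)) * (omg M ^+ n * conjc (omg M ^+ l)) ^+ j).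
  apply: eq_bigr => j _.
  rewrite -[LHS]mulcJ conjc_sum big_distrlr /=; apply: eq_bigr => n _.
  apply: eq_bigr => l _.
  rewrite conjcM !conjcX exprMn -!exprM ![(j * _)%N]mulnC.
  by rewrite mulrACA.
rewrite exchange_big /= mulr_sumr; apply: eq_bigr => n _.
rewrite exchange_big /= (bigD1 n) //= -mulr_sumr root_orth eqxx mul1r.
rewrite big1 ?addr0; first by rewrite -[X in _ = _ * X]mulcJ mulrC.
move=> l ln; rewrite -mulr_sumr root_orth eq_sym (negbTE ln) mul0r mulr0 //.
Qed.

(** With [x = omg^j w] one has [x^M = w^M], hence [1 / (1 - x) = (sum_(k < M) x^k) / (1 - w^M)];
    summing over [j] kills every power except [k = 0]. *)
Lemma kernel_roots M (w : C) : (0 < M)%N -> cm w < 1 ->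
  \sum_(j < M) (1 - omg M ^+ j * w)^-1 = M%:R * (1 - w ^+ M)^-1.
Proof.
move=> M0 w1.
have wM : cm (w ^+ M) < 1.
  by rewrite cmX exprn_ilt1 ?cm_ge0 // -lt0n.
have nz : 1 - w ^+ M != 0 by exact: one_sub_neq0.
transitivity (\sum_(j < M) (\sum_(k < M) (omg M ^+ j * w) ^+ k) * (1 - w ^+ M)^-1).
  apply: eq_bigr => j _; have nzj : 1 - omg M ^+ j * w != 0.
    by apply: one_sub_neq0; rewrite cmM cmX cm_omg expr1n mul1r.
  have := geo_kernel M nzj => /eqP; rewrite subr_eq => /eqP ->.
  rewrite exprMn -exprM mulnC exprM omg_M // expr1n mul1r.
  by apply: (mulIf nz); rewrite -[RHS]mulrA mulVf // mulr1; ring.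
rewrite -mulr_suml exchange_big /=; congr (_ * _).
rewrite (bigD1 (Ordinal M0)) //= (eq_bigr (fun=> 1)) => [|j _]; last by rewrite expr0.
rewrite sumr_const card_ord big1 ?addr0 // => k k0.
under eq_bigr do rewrite exprMn -exprM mulnC exprM.
rewrite -mulr_suml sum_root0 ?mul0r //.
  by rewrite -exprM mulnC exprM omg_M // expr1n.
apply: omgX_neq1; rewrite ltn_ord andbT lt0n.
by apply: contra k0 => /eqP h; apply/eqP/val_inj.
Qed.

Lemma grid_count (a b h : R) M : 0 < h -> a <= b ->
  \sum_(j < M) ((a < j%:R * h <= b)%R)%:R <= (b - a) / h + 1 :> R.
Proof.
move=> h0 ab.
(* Telescoping along the truncation of the grid to [a, b + h]. *)
pose cl (x : R) := Num.min (Num.max x a) (b + h).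
have clm x y : x <= y -> cl x <= cl y.
  move=> xy; rewrite /cl le_min ge_min; apply/andP; split.
    by rewrite ge_max le_max xy /= le_max lexx orbT.
  by rewrite ge_min lexx orbT.
have step j : ((a < j%:R * h <= b)%R)%:R <= (cl (j.+1%:R * h) - cl (j%:R * h)) / h.
  have [/andP[aj jb]|_] := boolP (a < j%:R * h <= b); last first.
    rewrite divr_ge0 ?(ltW h0) // subr_ge0 clm // ler_wpM2r ?(ltW h0) //.
    by rewrite ler_nat.
  rewrite (_ : cl (j%:R * h) = j%:R * h); last first.
    by rewrite /cl max_l ?(ltW aj) // min_l //; lra.
  rewrite (_ : cl (j.+1%:R * h) = j.+1%:R * h); last first.
    by rewrite /cl -natr1 mulrDl mul1r max_l ?min_l //; lra.
  have -> : j.+1%:R * h - j%:R * h = h by rewrite -natr1; ring.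
  by rewrite divff // gt_eqF.
apply: (@le_trans _ _ (\sum_(j < M) (cl (j.+1%:R * h) - cl (j%:R * h)) / h)).
  by apply: ler_sum => j _; exact: step.
rewrite -mulr_suml -[X in _ + X](@divff _ h) ?gt_eqF // -mulrDl.
rewrite ler_pM2r ?invr_gt0 //.
rewrite -(big_mkord xpredT (fun j => cl (j.+1%:R * h) - cl (j%:R * h))).
rewrite telescope_sumr //.
have h1 : cl (M%:R * h) <= b + h by rewrite /cl ge_min lexx orbT.
have h2 : a <= cl (0%:R * h) by rewrite /cl le_min le_max lexx orbT /=; lra.
lra.
Qed.

End RootsOfUnity.

(** * Theta is inner *)

Section InnerClark.
Variables (R : realType) (mu : {measure set R -> \bar R}).
Hypothesis mu1 : mu setT = 1%E.
Local Notation C := (R[i]).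
Local Notation Z := (@expi R).
Local Notation H := (Hz mu).

(** The Poisson kernel, in the form whose integral against [mu] is visibly [2 Re H - 1]; [poisE]
    gives the usual quotient. *)
Definition pois (z : C) (t : R) : R := 2 * complex.Re (cker z t) - 1.

Lemma two_Re_inv (w : C) : 1 - w != 0 ->
  2 * complex.Re ((1 - w)^-1) - 1 = (1 - sqn w) / sqn (1 - w).
Proof.
move=> w1; have : sqn (1 - w) != 0 by apply: contra w1 => /eqP/sqn_eq0 ->.
case: w {w1} => x y; rewrite /sqn /= sub0r sqrrN => h.
by field.
Qed.

Lemma poisE z t : cm z < 1 ->
  pois z t = (1 - sqn z) / sqn (1 - z * conjc (Z t)).
Proof.
move=> z1; rewrite /pois /cker two_Re_inv; last by rewrite one_sub_neq0 // cm_zJ.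
by rewrite sqnM sqnJ sqn_expi mulr1.
Qed.

Lemma pois_ge0 z t : cm z < 1 -> 0 <= pois z t.
Proof.
move=> z1; rewrite poisE // divr_ge0 ?sqn_ge0 // subr_ge0 -cm_sqr.
by rewrite exprn_ile1 ?cm_ge0 // ltW.
Qed.

Lemma bm_pois z : cm z < 1 -> bm (pois z).
Proof.
move=> z1; apply: bmB; last exact: bm_cst.
by apply: bmZ; exact: (proj1 (cbm_cker z1)).
Qed.

Lemma Ex_pois z : cm z < 1 -> Ex mu (pois z) = 2 * complex.Re (H z) - 1.
Proof.
move=> z1; have bR := proj1 (cbm_cker z1).
rewrite CE_ReE -(ExZ mu1 2 bR) -[X in _ - X](Ex_cst mu1).
rewrite -mulN1r -(ExZ mu1 _ (bm_cst 1)) -(ExD mu1); last 2 first.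
- exact: bmZ.
- exact: bmZ (bm_cst _).
by congr Ex; apply/funext => t; rewrite mulr1.
Qed.

Definition thz (z : C) : C := 1 - (H z)^-1.

(** Since [theta = 1 - 1 / H], one has [1 - |theta|^2 = (2 Re H - 1) / |H|^2], whose numerator is
    the Poisson integral of [mu]. Its nonnegativity gives [|H| >= Re H >= 1/2], which is the origin
    of the 4. *)
Lemma thz_bound z : cm z < 1 ->
  0 <= 1 - sqn (thz z) /\ 1 - sqn (thz z) <= 4 * Ex mu (pois z).
Proof.
move=> z1; have P0 : 0 <= Ex mu (pois z) by apply: Ex_ge0 => t; exact: pois_ge0.
rewrite Ex_pois // in P0 *; rewrite /thz; case: (H z) P0 => x y /= P0.
have x2 : 1 / 2 <= x by lra.
have h : 1 / 4 <= x ^+ 2 + y ^+ 2 by have := sqr_ge0 y; nra.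
have n0 : x ^+ 2 + y ^+ 2 != 0 by rewrite gt_eqF //; lra.
have -> : 1 - sqn (1 - (Complex x y)^-1) = (2 * x - 1) / (x ^+ 2 + y ^+ 2).
  by rewrite /sqn /=; field.
have hp : 0 < x ^+ 2 + y ^+ 2 by lra.
split; first by rewrite divr_ge0 // ltW.
by rewrite ler_pdivrMr //; nra.
Qed.

Lemma sqn_polar (r x : R) : sqn (1 - Complex r 0 * expi x) = 1 - 2 * r * cos x + r ^+ 2.
Proof.
transitivity (1 - 2 * r * cos x + r ^+ 2 * (cos x ^+ 2 + sin x ^+ 2)).
  by rewrite /sqn /=; ring.
by rewrite cos2Dsin2 mulr1.
Qed.

Lemma expiBJ (a s : R) : expi a * conjc (expi s) = expi (a - s).
Proof. by rewrite /expi cosB sinB; simpc; congr Complex; ring. Qed.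

Lemma cm_grid (r : R) a : 0 <= r -> cm (Complex r 0 * expi a) = r.
Proof. by move=> r0; rewrite cmM cm_real ger0_norm // cm_expi mulr1. Qed.

Lemma pois_sep (r d a s : R) : 1 / 2 <= r < 1 -> 0 < d <= pi ->
  d <= `|a - s| <= 2 * pi - d ->
  pois (Complex r 0 * expi a) s <= (1 - r ^+ 2) / (1 - cos d).
Proof.
move=> /andP[r2 r1] /andP[d0 dpi] h; have r0 : 0 <= r by lra.
have cs : cos (a - s) <= cos d by apply: cos_sep => //; rewrite (ltW d0).
have cd1 : cos d < 1 by apply: cos_lt1; have := pi_gt0 R; lra.
rewrite poisE ?cm_grid // -cm_sqr cm_grid // -mulrA expiBJ sqn_polar.
(* The difference of the two sides is at least [r^2 - (2 r - 1) cos d >= (1 - r)^2]; this uses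
   [r >= 1/2]. *)
have D : 1 - cos d <= 1 - 2 * r * cos (a - s) + r ^+ 2 by nra.
apply: ler_wpM2l; first by rewrite subr_ge0 exprn_ile1 // ltW.
by rewrite lef_pV2 ?posrE //; lra.
Qed.

(** By [kernel_roots] the mean is [2 Re (1 / (1 - w^M)) - 1 <= 2 * 2 - 1], because [|w^M| <= 1/2].
    The bound is uniform in [t], so the small part of [mu] off the covered set contributes little on
    average, although single values of the kernel may be huge. *)
Lemma pois_roots (M : nat) (z : C) t : (0 < M)%N -> cm z < 1 -> cm z ^+ M <= 1 / 2 ->
  \sum_(j < M) pois (z * omg R M ^+ j) t <= 3 * M%:R.
Proof.
move=> M0 z1 zM; set w := z * conjc (Z t).
have w1 : cm w < 1 by rewrite /w cm_zJ.
rewrite /pois sumrB sumr_const card_ord -mulr_sumr -Re_sum.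
have -> : \sum_(j < M) cker (z * omg R M ^+ j) t = M%:R * (1 - w ^+ M)^-1.
  by rewrite -kernel_roots //; apply: eq_bigr => j _; rewrite /cker /w; congr (_^-1); ring.
have -> : complex.Re (M%:R * (1 - w ^+ M)^-1) = M%:R * complex.Re ((1 - w ^+ M)^-1).
  rewrite (_ : M%:R = Complex M%:R 0 :> C); first by rewrite ReM /= mul0r subr0.
  by rewrite -[Complex _ 0]/(real_complex R M%:R) rmorph_nat.
have : complex.Re ((1 - w ^+ M)^-1) <= 2.
  apply: le_trans (ler_norm _) _; apply: le_trans (Re_le_cm _) _.
  have h : 1 / 2 <= cm (1 - w ^+ M).
    by apply: le_trans (cm_1B _); rewrite cmX /w cm_zJ; lra.
  by rewrite cmV -[leRHS]invrK lef_pV2 ?posrE; lra.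
have M1 : 0 < M%:R :> R by rewrite ltr0n.
by rewrite -[1 *+ M]/(M%:R); nra.
Qed.

Hypothesis muT : mu (~` @Tpar R)%classic = 0%E.
Variable N : set R.
Hypothesis mN : measurable N.
Hypothesis N0 : (@lebesgue_measure R) N = 0%E.
Hypothesis muN : mu (~` N)%classic = 0%E.

(* The exceptional grid points lie in d-enlargements of the intervals carrying
   mu up to e, with 0 and 2 pi added to account for the wrap-around. *)
Lemma bad_grid (e : R) : 0 < e -> exists (d : R) (bad : pred R) (n : nat) (K : set R),
  [/\ 0 < d <= pi, measurable K, (mu (~` K) <= e%:E)%E,
   forall a s, 0 <= a < 2 * pi -> ~~ bad a -> K s -> d <= `|a - s| <= 2 * pi - d &
   forall M, (0 < M)%N ->
     \sum_(j < M) (bad (j%:R * (2 * pi / M%:R)))%:R <= 3 * e * M%:R + n%:R :> R].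
Proof.
move=> e0; have p0 := pi_gt0 R; have p2 := pi_ge2 R.
have mT : measurable (@Tpar R) by exact: measurable_itv.
have [I0 [K [I0s I0e [mK KT] muK KI]]] := singular_cover mu1 mT muT mN N0 muN e0.
pose I : seq (R * R) := (0, 0) :: (2 * pi, 2 * pi) :: I0.
pose n := size I; have n0 : 0 < n%:R :> R by rewrite ltr0n.
(* Enlarging the [n] intervals by [d] on both sides adds at most [2 e] to their total length, whence
   the [3 e] in the count; [d <= 1] keeps [d] below [pi]. *)
pose d := Num.min 1 (e / n%:R).
have d0 : 0 < d by rewrite /d lt_min ltr01 divr_gt0.
have dn : d * n%:R <= e by rewrite -ler_pdivlMr // /d ge_min lexx orbT.
have d1 : d <= 1 by rewrite /d ge_min lexx.
pose bad (x : R) := has (fun ab : R * R => ab.1 - d < x <= ab.2 + d) I.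
exists d, bad, n, K; split => //.
- by rewrite d0 /=; lra.
- move=> a s /andP[a0 a2] /hasPn nb Ks.
  have := nb (0, 0); rewrite in_cons eqxx /= => /(_ isT) b1.
  have := nb (2 * pi, 2 * pi); rewrite !in_cons eqxx orbT /= => /(_ isT) b2.
  have da : d < a.
    by rewrite ltNge; apply/negP => h; move/negP: b1; apply; apply/andP; split; lra.
  have ad : a <= 2 * pi - d.
    by rewrite leNgt; apply/negP => h; move/negP: b2; apply; apply/andP; split; lra.
  have /hasP[[x y] /= xyI /andP[xs sy]] := KI _ Ks.
  have := nb (x, y); rewrite !in_cons xyI !orbT /= => /(_ isT) b3.
  have s02 : 0 <= s < 2 * pi by have := KT _ Ks; rewrite /Tpar /= in_itv.
  move/andP: s02 => [s0 s2].
  apply/andP; split; last by rewrite ler_norml; apply/andP; split; lra.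
  have [h|h] := leP a (x - d).
    by rewrite ler_normr; apply/orP; right; lra.
  have : ~~ (a <= y + d) by apply: contra b3 => h'; rewrite h h'.
  by rewrite -ltNge => h'; rewrite ler_normr; apply/orP; left; lra.
move=> M M0; have M1 : 0 < M%:R :> R by rewrite ltr0n.
set h := 2 * pi / M%:R; have h0 : 0 < h by rewrite divr_gt0 // mulr_gt0.
have Is : all (fun ab => ab.1 <= ab.2) I by rewrite /= !lexx.
have Ie : \sum_(ab <- I) (ab.2 - ab.1) <= e by rewrite !big_cons /= !subrr !add0r.
apply: (@le_trans _ _ (\sum_(j < M) \sum_(ab <- I)
    ((ab.1 - d < j%:R * h <= ab.2 + d)%R)%:R)).
  apply: ler_sum => j _; rewrite /bad.
  have [/hasP[ab abI hab]|_] := boolP (has _ _); last first.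
    by apply: sumr_ge0 => *; exact: ler0n.
  by rewrite (big_rem ab) //= hab lerDl sumr_ge0 // => *; exact: ler0n.
rewrite exchange_big /=.
apply: (@le_trans _ _ (\sum_(ab <- I) ((ab.2 - ab.1 + 2 * d) / h + 1))).
  rewrite big_seq [leRHS]big_seq; apply: ler_sum => ab abI.
  have := grid_count M h0 (_ : ab.1 - d <= ab.2 + d).
  rewrite (_ : ab.2 + d - (ab.1 - d) = ab.2 - ab.1 + 2 * d); last by ring.
  by apply; have := allP Is _ abI => /= ?; lra.
rewrite big_split /= -mulr_suml big_split /=.
have -> : \sum_(i <- I) 2 * d = n%:R * (2 * d).
  by rewrite (big_const_seq (0 : R)) count_predT iter_addr_0 -[LHS]mulr_natl.
have -> : \sum_(i <- I) 1 = n%:R :> R.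
  by rewrite (big_const_seq (0 : R)) count_predT iter_addr_0.
rewrite lerD2r ler_pdivrMr // /h.
have -> : 3 * e * M%:R * (2 * pi / M%:R) = 6 * e * pi by field; rewrite gt_eqF.
nra.
Qed.

(** The order of the quantifiers matters: [r] must first be close to 1 for the Poisson kernel to be
    small at distance [d], and only then is [M] taken so large that [r^M <= 1/2] and that the
    constant number [n] of extra bad points is negligible. *)
Lemma inner_avg (e : R) : 0 < e -> exists2 rho : R, 0 < rho < 1 &
  forall r, rho <= r < 1 -> exists M0, forall M, (M0 <= M)%N ->
  \sum_(j < M) (1 - sqn (thz (Complex r 0 * omg R M ^+ j))) <= e * M%:R.
Proof.
(* 20 = 3 + 1 + 4 (1 + 3). Bad grid points cost at most [3 e1 M + n] with [n <= e1 M]; at the others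
   [4 P[mu]] costs [4 e1] each from [K], and in total [4 * 3 e1 M] from the complement of [K]. *)
move=> e0; pose e1 := e / 20; have e10 : 0 < e1 by rewrite divr_gt0.
have [d [bad [n [K [dd mK muK sep cnt]]]]] := bad_grid e10.
have cd1 : cos d < 1 by apply: cos_lt1; have := pi_gt0 R; lra.
(* Chosen so that [1 - r^2 <= 2 (1 - r) <= e1 (1 - cos d)], which makes the bound of [pois_sep] at
   most [e1]. *)
pose rho := Num.max (1 / 2) (1 - e1 * (1 - cos d) / 2).
have rho2 : 1 / 2 <= rho by rewrite le_max lexx.
have rho1 : rho < 1.
  rewrite gt_max; apply/andP; split; first by lra.
  have : 0 < e1 * (1 - cos d) by rewrite mulr_gt0 // subr_gt0.
  lra.
exists rho; first by apply/andP; split; lra.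
move=> r /andP[rrho r1]; have r2 : 1 / 2 <= r by lra.
have r0 : 0 <= r by lra.
have eta : (1 - r ^+ 2) / (1 - cos d) <= e1.
  rewrite ler_pdivrMr ?subr_gt0 //.
  have : 1 - e1 * (1 - cos d) / 2 <= r by rewrite (le_trans _ rrho) // le_max lexx orbT.
  nra.
have [A hA] := @geo_small R 1 r (introT andP (conj r0 r1)) (1 / 2) ltac:(lra).
have [B hB] : exists B : nat, n%:R / e1 <= B%:R.
  by exists (Num.truncn (n%:R / e1)).+1; rewrite ltW // truncnS_gt.
exists (maxn 1 (maxn A B)) => M; rewrite !geq_max => /and3P[M0 AM BM].
have M1 : 0 < M%:R :> R by rewrite ltr0n.
have zE (j : 'I_M) : Complex r 0 * omg R M ^+ j = Complex r 0 * expi (j%:R * (2 * pi / M%:R)).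
  by rewrite /omg expiX.
pose z (j : 'I_M) := Complex r 0 * omg R M ^+ j.
have z1 j : cm (z j) < 1 by rewrite /z zE cm_grid.
have bK : bm (\1_(~` K) : R -> R) by apply: bm_indic; exact: measurableC.
have iK0 t : 0 <= (\1_(~` K) : R -> R) t by rewrite indicE ler0n.
pose X j := Ex mu (fun t => \1_(~` K) t * pois (z j) t).
have bX j : bm (fun t => \1_(~` K) t * pois (z j) t) by exact: bmM bK (bm_pois (z1 j)).
have X0 j : 0 <= X j by apply: Ex_ge0 => t; rewrite mulr_ge0 // pois_ge0.
have step (j : 'I_M) : 1 - sqn (thz (z j)) <=
    (bad (j%:R * (2 * pi / M%:R)))%:R + 4 * (e1 + X j).
  have [h1 h2] := thz_bound (z1 j).
  case: (boolP (bad _)) => [_|nb].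
    have := sqn_ge0 (thz (z j)); have := X0 j; rewrite /=; lra.
  rewrite add0r (le_trans h2) // ler_pM2l //.
  rewrite -(Ex_cst mu1 e1) -(ExD mu1) //; last exact: bm_cst.
  apply: Ex_le => //; [exact: bm_pois|by apply: bmD => //; exact: bm_cst|].
  move=> t; have [Kt|nKt] := pselect (K t); last first.
    by rewrite indicE mem_set // mul1r lerDr ltW.
  rewrite indicE memNset ?mul0r ?addr0; last by move=> /(_ Kt).
  apply: le_trans eta; rewrite /z zE; apply: pois_sep => //.
    by rewrite r2.
  apply: sep => //; rewrite mulr_ge0 ?ler0n ?divr_ge0 ?mulr_ge0 ?pi_ge0 //=.
  rewrite mulrCA gtr_pMr; last by rewrite mulr_gt0 // pi_gt0.
  by rewrite ltr_pdivrMr // mul1r ltr_nat.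
apply: le_trans (ler_sum _ (fun j _ => step j)) _.
rewrite big_split /= -mulr_sumr big_split /= sumr_const card_ord -[e1 *+ M]mulr_natr.
have SX : \sum_(j < M) X j <= 3 * M%:R * e1.
  rewrite -(Ex_sum mu1) //.
  apply: (@le_trans _ _ (Ex mu (fun t => (3 * M%:R) * \1_(~` K) t))).
    apply: Ex_le => //; [exact: bm_sum|exact: bmZ|move=> t].
    rewrite -mulr_sumr mulrC ler_wpM2r //.
    apply: pois_roots => //; rewrite cm_real ger0_norm //.
    by have := hA M AM; rewrite mul1r => /ltW.
  rewrite (ExZ mu1) // Ex_indic; last exact: measurableC.
  rewrite ler_wpM2l ?mulr_ge0 ?ler0n // -lee_fin fineK // ge0_fin_numE //.
  by rewrite (le_lt_trans muK) // ltry.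
have := cnt M M0.
have : n%:R <= e1 * M%:R.
  rewrite mulrC -ler_pdivrMr // (le_trans hB) // ler_nat //.
have -> : e = 20 * e1 by rewrite /e1; lra.
move: SX; set SX := \sum_(j < M) X j; nra.
Qed.

End InnerClark.

(** * Multiplication by theta is isometric on square-summable sequences *)

Section Isometry.
Variables (R : realType) (mu : {measure set R -> \bar R}).
Hypothesis mu1 : mu setT = 1%E.
Hypothesis muT : mu (~` @Tpar R)%classic = 0%E.
Variable N0 : set R.
Hypothesis mN : measurable N0.
Hypothesis lN : (@lebesgue_measure R) N0 = 0%E.
Hypothesis muN : mu (~` N0)%classic = 0%E.
Local Notation C := (R[i]).
Local Notation th := (thc mu1).
Implicit Types (a b u v : nat -> C) (c : C).

Lemma bernoulli_le (x : R) n : 0 <= x <= 1 -> 1 - n%:R * x <= (1 - x) ^+ n.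
Proof.
move=> /andP[x0 x1]; elim: n => [|n IH]; first by rewrite mul0r subr0 expr0.
rewrite exprS -natr1; have := ler0n R n; have : (1 - x) ^+ n <= 1.
  by rewrite exprn_ile1 //; lra.
nra.
Qed.

Lemma sqn_le_cm (x : C) (B : R) : cm x <= B -> sqn x <= B ^+ 2.
Proof.
move=> h; rewrite -cm_sqr lerXn2r // ?nnegrE ?cm_ge0 //.
exact: le_trans (cm_ge0 _) h.
Qed.

(** The function [theta (1 + c z^k)] is sampled at the points [r omg^j]. There [|theta|^2] is close
    to 1 on average, and the mean of [|1 + c z^k|^2] is [1 + r^(2k)], close to 2. The losses are
    [e/8] from [r^(2k)], [4 * e/16] from [inner_avg] and [e/8] from cutting the series at [M]. *)
Lemma two_term_lower c (k : nat) (e : R) : sqn c = 1 -> (0 < k)%N -> 0 < e ->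
  exists M, 2 - e <= \sum_(n < M) sqn (lin c (shift k th) th n).
Proof.
move=> c1 k0 e0; pose b := lin c (shift k th) th.
have cc : cm c = 1 by rewrite cmE c1 sqrtr1.
have e160 : 0 < e / 16 by rewrite divr_gt0.
have [rho /andP[rho0 rho1] hrho] := inner_avg mu1 muT mN lN muN e160.
(* The distance [1 - r]: the first bound puts [r] above [rho], the last one gives
   [r^(2k) >= 1 - e/8] by Bernoulli. *)
pose x := Num.min (1 - rho) (Num.min 1 (e / (8 * k.*2%:R))).
have k2 : 0 < 8 * k.*2%:R :> R by rewrite mulr_gt0 // ltr0n double_gt0.
have x0 : 0 < x by rewrite /x !lt_min subr_gt0 rho1 ltr01 divr_gt0.
have xr : x <= 1 - rho by rewrite /x ge_min lexx.
have x1 : x <= 1 by rewrite /x !ge_min lexx orbT.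
have xk : k.*2%:R * x <= e / 8.
  have : x <= e / (8 * k.*2%:R) by rewrite /x !ge_min lexx !orbT.
  by rewrite ler_pdivlMr // => h; nra.
pose r := 1 - x.
have r0 : 0 <= r by rewrite /r; lra.
have r1 : r < 1 by rewrite /r; lra.
have r01 : 0 <= r < 1 by rewrite r0.
have rk : 1 - e / 8 <= r ^+ k.*2.
  by apply: le_trans (bernoulli_le _ _); [lra|rewrite (ltW x0)].
have [|M0 hM0] := hrho r; first by rewrite /r; apply/andP; split; lra.
have e320 : 0 < e / 32 by rewrite divr_gt0.
(* The coefficients are at most 2 in modulus, so this bounds the tail beyond [M] by [e/32]; as
   [|f| <= 2], squaring turns it into a loss of at most [e/8]. *)
have [M1 hM1] := @geo_small R (2 / (1 - r)) r r01 (e / 32) e320.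
have [M [kM M0M M1M Mpos]] : exists M, [/\ (k < M)%N, (M0 <= M)%N, (M1 <= M)%N & (0 < M)%N].
  by exists (maxn k.+1 (maxn M0 M1)); split; rewrite !leq_max ?leqnn ?orbT.
exists M.
have M0' : 0 < M%:R :> R by rewrite ltr0n.
pose z (j : 'I_M) := Complex r 0 * omg R M ^+ j.
have zr j : cm (z j) = r by rewrite /z cmM cm_real ger0_norm // cmX cm_omg expr1n mulr1.
have z1 j : cm (z j) < 1 by rewrite zr.
pose f (w : C) := thz mu w * (1 + c * w ^+ k).
have bf (w : disk R) : ccvg (psum (fun n => b n * val w ^+ n)) (f (val w)).
  have tb := taylor_lin c (taylor_shift k (thc_taylor mu1)) (thc_taylor mu1).
  have /is_taylorP/(_ w) := tb; congr ccvg.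
  by rewrite /f /thz /clark_theta /Hz /cker; ring.
have b2 n : cm (b n) <= 2.
  rewrite (le_trans (cmD _ _)) // cmM cc mul1r.
  have -> : 2 = 1 + 1 :> R by [].
  rewrite lerD ?cm_thc_le1 // /shift; case: ifP => _; rewrite ?cm0 ?cm_thc_le1 //.
have tail j : cm (f (z j) - psum (fun n => b n * z j ^+ n) M) <= e / 32.
  have := psum_tail (B := 2) M r01 _ (bf (exist _ (z j) (mkdisk (z1 j)))).
  move=> /(_ _)/le_trans; apply.
    by move=> n; rewrite cmM cmX /= zr ler_wpM2r ?exprn_ge0.
  by rewrite mulrAC; exact: ltW (hM1 M M1M).
have u2 j : cm (1 + c * z j ^+ k) <= 2.
  rewrite (le_trans (cmD _ _)) // cm1 cmM cc mul1r cmX zr.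
  have -> : 2 = 1 + 1 :> R by [].
  by rewrite lerD2l exprn_ile1 // ltW.
have thj j : 0 <= 1 - sqn (thz mu (z j)) by have [] := thz_bound mu1 (z1 j).
have f2 j : cm (f (z j)) <= 2.
  rewrite /f cmM -[leRHS]mul1r ler_pM ?cm_ge0 //.
  rewrite -(ler_pXn2r (ltn0Sn 1)) ?nnegrE ?cm_ge0 // expr1n cm_sqr.
  by have := thj j; rewrite subr_ge0.
have pt j : sqn (1 + c * z j ^+ k) - 4 * (1 - sqn (thz mu (z j))) - e / 8 <=
    sqn (psum (fun n => b n * z j ^+ n) M).
  have h1 : sqn (1 + c * z j ^+ k) <= 4.
    by rewrite (_ : 4 = 2 ^+ 2) ?(sqn_le_cm (u2 j)) // -natrX.
  have h2 : sqn (f (z j)) = sqn (thz mu (z j)) * sqn (1 + c * z j ^+ k) by rewrite /f sqnM.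
  have h3 : sqn (f (z j)) - e / 8 <= sqn (psum (fun n => b n * z j ^+ n) M).
    have := tail j; have := f2 j; rewrite -!cm_sqr.
    have := cmD (f (z j) - psum (fun n => b n * z j ^+ n) M) (psum (fun n => b n * z j ^+ n) M).
    rewrite subrK; set p := cm (f (z j)); set q := cm (psum _ _); set s := cm (_ - _).
    have p0 : 0 <= p by exact: cm_ge0.
    have q0 : 0 <= q by exact: cm_ge0.
    clear -e0 p0 q0; move=> hp p2 hs; have [pq|qp] := leP p q; nra.
  have := thj j; have := sqn_ge0 (1 + c * z j ^+ k); clear -h1 h2 h3; nra.
(* Discrete Parseval is exact for polynomials of degree below [M], which is why the series was cut;
   the weights [r^(2n)] are then dropped. *)
have S1 : M%:R * \sum_(n < M) sqn (b n) >= \sum_(j < M) sqn (psum (fun n => b n * z j ^+ n) M).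
  have -> : \sum_(j < M) sqn (psum (fun n => b n * z j ^+ n) M) =
      \sum_(j < M) sqn (\sum_(n < M) (fun n => b n * Complex r 0 ^+ n) n * (omg R M ^+ j) ^+ n).
    apply: eq_bigr => j _; congr sqn; apply: eq_bigr => n _.
    by rewrite /z exprMn mulrA.
  rewrite (parseval_roots M (fun n => b n * Complex r 0 ^+ n)) ler_wpM2l ?ler0n //.
  apply: ler_sum => n _; rewrite sqnM ler_piMr ?sqn_ge0 // -cm_sqr cmX cm_real ger0_norm //.
  by rewrite -exprM exprn_ile1 // ltW.
have S2 : M%:R * (1 + r ^+ k.*2) <= \sum_(j < M) sqn (1 + c * z j ^+ k).
  pose d n := (delta R 0 n + c * delta R k n) * Complex r 0 ^+ n.

  have -> : \sum_(j < M) sqn (1 + c * z j ^+ k) =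
      \sum_(j < M) sqn (\sum_(n < M) d n * (omg R M ^+ j) ^+ n); last first.
    rewrite (parseval_roots M d) ler_wpM2l ?ler0n //.
    rewrite (bigD1 (Ordinal Mpos)) //= (bigD1 (Ordinal kM)) /=; last first.
      by apply/eqP => -[h]; rewrite h in k0.
    rewrite /d /delta eqxx (gtn_eqF k0) (ltn_eqF k0) eqxx mulr0 addr0 add0r !mulr1.
    rewrite addrA -[leLHS]addr0 lerD //; last first.
      by apply: sumr_ge0 => *; exact: sqn_ge0.
    rewrite sqnM c1 mul1r -[sqn 1]cm_sqr cm1 expr1n -cm_sqr cmX cm_real ger0_norm //.
    by rewrite -exprM muln2.
  apply: eq_bigr => j _; congr sqn; rewrite (bigD1 (Ordinal Mpos)) //= (bigD1 (Ordinal kM)) /=; last first.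
    by apply/eqP => -[h]; rewrite h in k0.
  rewrite big1 => [|i /andP[i0 ik]].
    rewrite /d /delta eqxx (gtn_eqF k0) (ltn_eqF k0) eqxx mulr0 !addr0 add0r !mulr1.
    by rewrite /z exprMn mulrA.
  rewrite /d /delta.
  have -> : (i == 0 :> nat)%N = false.
    by apply/negbTE; apply: contra i0 => /eqP h; apply/eqP/val_inj.
  have -> : (i == k :> nat)%N = false.
    by apply/negbTE; apply: contra ik => /eqP h; apply/eqP/val_inj.
  by rewrite mulr0 addr0 !mul0r.
have S3 := hM0 M M0M.
have := ler_sum (index_enum _) (fun j (_ : true) => pt j) => S4.
have {S4} : \sum_(j < M) sqn (1 + c * z j ^+ k) - 4 * (\sum_(j < M) (1 - sqn (thz mu (z j))))
   - M%:R * (e / 8) <= \sum_(j < M) sqn (psum (fun n => b n * z j ^+ n) M).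
  move: S4; rewrite !sumrB -mulr_sumr sumr_const card_ord -[_ *+ M]mulr_natl !sumrB.
  by [].
move: S1 S2 S3; rewrite -/b; set B := \sum_(n < M) sqn (b n).
set U := \sum_(j < M) sqn (1 + _); set V := \sum_(j < M) (1 - _); set W := \sum_(j < M) sqn _.
have Me := mulr_gt0 M0' e0; have Mrk := ler_wpM2l (ltW M0') rk.
clear -Me Mrk M0'; move=> S1 S2 S3 S4.
by rewrite -(ler_pM2l M0'); lra.
Qed.

Lemma l2_th : l2 th. Proof. exact: thc_l2. Qed.

(** Both norms in the expansion of [||c z^k theta + theta||^2] are at most 1, while the whole is at
    least 2. So [Re (c <z^k theta, theta>) >= 0] for every unimodular [c], and four values of [c]
    force the inner product to vanish. *)
Lemma th_orth0 k : (0 < k)%N -> ip (shift k th) th = 0.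
Proof.
move=> k0; have lt := l2_th; have ls := l2_shift k lt.
have t1 : nrm2 th <= 1 by apply: nrm2_le; exact: thc_bessel.
have key c : sqn c = 1 -> 0 <= complex.Re (c * ip (shift k th) th).
  move=> c1; have : 2 <= nrm2 (lin c (shift k th) th).
    apply/ler_addgt0Pr => e e0; have [M hM] := two_term_lower c1 k0 e0.
    by have := nrm2_partial M (l2_lin c ls lt); lra.
  by rewrite nrm2_lin // c1 mul1r nrm2_shift //; lra.
have s1 : sqn (1 : C) = 1 by rewrite -cm_sqr cm1 expr1n.
have s2 : sqn (-1 : C) = 1 by rewrite sqnN.
have s3 : sqn (Complex 0 1 : C) = 1 by rewrite /sqn /= expr0n expr1n add0r.
have s4 : sqn (- Complex 0 1 : C) = 1 by rewrite sqnN.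
have := key _ s1; have := key _ s2; have := key _ s3; have := key _ s4.
case: (ip _ _) => x y /=.
rewrite ?ReM /= => h1 h2 h3 h4; apply: complexP => /=; lra.
Qed.

Lemma th_nrm2 : nrm2 th = 1.
Proof.
have lt := l2_th; have ls := l2_shift 1 lt.
apply/eqP; rewrite eq_le; apply/andP; split; first by apply: nrm2_le; exact: thc_bessel.
have s1 : sqn (1 : C) = 1 by rewrite -cm_sqr cm1 expr1n.
have : 2 <= nrm2 (lin 1 (shift 1 th) th).
  apply/ler_addgt0Pr => e e0; have [M hM] := two_term_lower s1 (ltn0Sn 0) e0.
  by have := nrm2_partial M (l2_lin 1 ls lt); lra.
by rewrite nrm2_lin // s1 mul1r nrm2_shift // th_orth0 // mulr0 /=; lra.
Qed.

Lemma shiftD i k a : shift (i + k) a = shift i (shift k a).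
Proof.
apply/funext => n; rewrite /shift; case: ltnP => h1; case: ltnP => h2 //.
- by rewrite (_ : (n - i < k)%N = true) //; lia.
- by lia.
- by rewrite (_ : (n - i < k)%N = false) ?subnDA //; lia.
Qed.

Lemma th_orth i j : ip (shift i th) (shift j th) = (i == j)%:R.
Proof.
have lt := l2_th.
have lt_case p q : (p < q)%N -> ip (shift q th) (shift p th) = 0.
  move=> pq; rewrite -(subnKC (ltnW pq)) shiftD ip_shift //; last exact: l2_shift.
  by rewrite th_orth0 // subn_gt0.
case: (ltngtP i j) => [ij|ji|->].
- by rewrite ipC ?lt_case ?conjc0 //; exact: l2_shift.
- exact: lt_case.
by rewrite ip_shift // ip_self // th_nrm2.
Qed.

Lemma conv_shift_sum a u N n : (n < N)%N -> conv a u n = \sum_(i < N) u i * shift i a n.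
Proof.
move=> nN; rewrite convC /conv (big_ord_widen N (fun k => u k * a (n - k)%N) nN).
rewrite big_mkcond; apply: eq_bigr => i _; rewrite /shift ltnS [(n < i)%N]ltnNge.
by case: ifP => _; rewrite ?mulr0.
Qed.

Lemma conv_trunc a u N n : conv a (trunc N u) n = \sum_(i < N) u i * shift i a n.
Proof.
rewrite (@conv_shift_sum _ _ (N + n.+1)) ?leq_addl // big_split_ord /=.
rewrite [X in _ + X]big1 ?addr0 => [|i _].
  by apply: eq_bigr => i _; rewrite /trunc ltn_ord.
by rewrite /trunc ltnNge leq_addr /= mul0r.
Qed.

Lemma th_comb_nrm2 N u :
  nrm2 (fun n => \sum_(i < N) u i * shift i th n) = \sum_(i < N) sqn (u i).
Proof.
have ls i : l2 (shift i th) by apply: l2_shift; exact: l2_th.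
rewrite /nrm2 ip_suml; [|by move=> i; exact: ls|by apply: l2_sum => i; exact: ls].
rewrite Re_sum; apply: eq_bigr => i _.
rewrite ip_sumr; [|by move=> j; exact: ls|exact: ls].
rewrite (bigD1 i) //= th_orth eqxx mulr1 big1 ?addr0 ?mulcJ // => j ji.
by rewrite th_orth eq_sym (negbTE (_ : val j != val i)) ?mulr0 // (inj_eq val_inj).
Qed.

(** The first [N] coefficients of the product involve only [u_0, ..., u_(N-1)], so they agree with
    those of a finite combination of the orthonormal shifts. *)
Lemma conv_th_partial N u : l2 u -> \sum_(n < N) sqn (conv th u n) <= nrm2 u.
Proof.
move=> lu; apply: le_trans (nrm2_partial N lu); rewrite -(th_comb_nrm2 N u).
apply: (@le_trans _ _ (\sum_(n < N) sqn (\sum_(i < N) u i * shift i th n))).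
  by apply: ler_sum => n _; rewrite (conv_shift_sum _ _ (ltn_ord n)).
apply: nrm2_partial; apply: l2_sum => i; apply: l2_shift; exact: l2_th.
Qed.

Lemma conv_th_l2 u : l2 u -> l2 (conv th u).
Proof. by move=> lu; exists (nrm2 u) => N; exact: conv_th_partial. Qed.

Lemma conv_th_le u : l2 u -> nrm (conv th u) <= nrm u.
Proof.
move=> lu; apply: ler_wsqrtr; apply: nrm2_le => N; exact: conv_th_partial.
Qed.

Lemma conv_lin a c u v : conv a (lin c u v) = lin c (conv a u) (conv a v).
Proof.
apply/funext => n; rewrite /lin /conv mulr_sumr -big_split /=.
by apply: eq_bigr => i _; ring.
Qed.

Lemma nrm2_trunc N u : nrm2 (trunc N u) = \sum_(n < N) sqn (u n).
Proof.
rewrite /nrm2 ip_truncl Re_sum; apply: eq_bigr => i _.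
by rewrite /trunc ltn_ord mulcJ.
Qed.

Lemma conv_th_nrm u : l2 u -> nrm (conv th u) = nrm u.
Proof.
move=> lu; apply/eqP; rewrite eq_le conv_th_le //=.
apply/ler_addgt0Pr => e e0; have e20 : 0 < e / 2 by rewrite divr_gt0.
have [N hN] := trunc_approx lu e20.
pose d n := u n - trunc N u n; have ld : l2 d by apply: l2B => //; exact: l2_trunc.
have lt := l2_trunc N u.
have E1 : nrm (conv th (trunc N u)) = nrm (trunc N u).
  by rewrite /nrm nrm2_trunc (funext (conv_trunc th u N)) th_comb_nrm2.
have E2 : nrm u <= nrm (trunc N u) + nrm d.
  apply: le_trans (nrmD lt ld); rewrite le_eqVlt; apply/orP; left; apply/eqP.
  by congr nrm; apply/funext => n; rewrite /d addrC subrK.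
have E3 : nrm (conv th (trunc N u)) <= nrm (conv th u) + nrm (conv th d).
  apply: le_trans (nrmB (conv_th_l2 lu) (conv_th_l2 ld)).
  rewrite le_eqVlt; apply/orP; left; apply/eqP; congr nrm.
  apply/funext => n; rewrite /conv -sumrB; apply: eq_bigr => i _.
  by rewrite /d; ring.
have := conv_th_le ld; rewrite -/d in hN; lra.
Qed.

Lemma conv_th_nrm2 u : l2 u -> nrm2 (conv th u) = nrm2 u.
Proof.
by move=> lu; rewrite -!nrm_sqr ?conv_th_nrm //; exact: conv_th_l2.
Qed.

Lemma conv_th_ip u v : l2 u -> l2 v -> ip (conv th u) (conv th v) = ip u v.
Proof.
move=> lu lv; have lcu := conv_th_l2 lu; have lcv := conv_th_l2 lv.
have key c : complex.Re (c * ip (conv th u) (conv th v)) = complex.Re (c * ip u v).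
  have := conv_th_nrm2 (l2_lin c lu lv); rewrite conv_lin !nrm2_lin //.
  by rewrite !conv_th_nrm2 //; lra.
have := key 1; have := key (Complex 0 1).
case: (ip _ _) => x y; case: (ip _ _) => s t; rewrite ?ReM /= => h1 h2.
by apply: complexP => /=; lra.
Qed.

End Isometry.

(** * The Clark transform of trigonometric polynomials *)

Section ConvAlgebra.
Variable R : realType.
Local Notation C := (R[i]).
Implicit Types (a b c u v w : nat -> C).

Lemma conjcD (x y : C) : conjc (x + y) = conjc x + conjc y.
Proof. exact: rmorphD. Qed.
Lemma conjcB (x y : C) : conjc (x - y) = conjc x - conjc y.
Proof. exact: rmorphB. Qed.
Lemma conjcN (x : C) : conjc (- x) = - conjc x.
Proof. exact: rmorphN. Qed.

Lemma conv_poly N a b n : (n < N)%N ->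
  conv a b n = ((\poly_(i < N) a i) * (\poly_(i < N) b i))`_n.
Proof.
move=> nN; rewrite coefM; apply: eq_bigr => i _.
by rewrite !coef_poly (leq_ltn_trans (leq_subr _ _) nN) (leq_trans (ltn_ord i) nN).
Qed.

(** The coefficient at [n] sees only the first [n + 1] terms of each sequence, so associativity is
    inherited from polynomials. *)
Lemma convA a b c : conv a (conv b c) = conv (conv a b) c.
Proof.
apply/funext => n.
pose P (x : nat -> C) := \poly_(i < n.+1) x i.
transitivity ((P a * (P b * P c))`_n).
  rewrite coefM; apply: eq_bigr => i _; rewrite coef_poly ltn_ord.
  by rewrite (@conv_poly n.+1) // ltnS leq_subr.
rewrite mulrA coefM; apply: eq_bigr => i _.
by rewrite coef_poly ltnS leq_subr (@conv_poly n.+1).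
Qed.

Lemma convCf a b : conv a b = conv b a. Proof. exact/funext/convC. Qed.

Lemma conv_shift a k b : conv a (shift k b) = shift k (conv a b).
Proof. by rewrite -!(funext (conv_delta k _)) convA (convCf a) -convA. Qed.

Lemma convBr a b c : conv a (fun n => b n - c n) = (fun n => conv a b n - conv a c n).
Proof.
by apply/funext => n; rewrite /conv -sumrB; apply: eq_bigr => i _; rewrite mulrBr.
Qed.

Lemma convDr a b c : conv a (fun n => b n + c n) = (fun n => conv a b n + conv a c n).
Proof.
by apply/funext => n; rewrite /conv -big_split; apply: eq_bigr => i _; rewrite /= mulrDr.
Qed.

Lemma l2_conv_trunc u N a : l2 u -> l2 (conv u (trunc N a)).
Proof.
move=> lu; rewrite (funext (conv_trunc u a N)).
by apply: l2_sum => i; exact: l2_shift.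
Qed.

(** An inner product of shifts depends only on [i - j], and reversing both indices while exchanging
    them preserves this difference. *)
Lemma ip_shift_rev L u v (i j : 'I_L) : l2 u -> l2 v ->
  ip (shift i u) (shift j v) = ip (shift (rev_ord j) u) (shift (rev_ord i) v).
Proof.
move=> lu lv /=; have iL := ltn_ord i; have jL := ltn_ord j.
have [ij|/ltnW ji] := leqP i j.
  rewrite -{1}(addn0 i) -{1}(subnKC ij) !shiftD ip_shift; try exact: l2_shift.
  rewrite -[(L - j.+1)%N]addn0 [(L - i.+1)%N](_ : _ = (L - j.+1) + (j - i))%N; last by lia.
  by rewrite !shiftD ip_shift //; exact: l2_shift.
rewrite -{1}(addn0 j) -{1}(subnKC ji) !shiftD ip_shift; try exact: l2_shift.
rewrite -[(L - i.+1)%N]addn0 [(L - j.+1)%N](_ : _ = (L - i.+1) + (i - j))%N; last by lia.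
by rewrite !shiftD ip_shift //; exact: l2_shift.
Qed.

(* Multiplication by conj A on the circle is, up to a power of z,
   multiplication by the reversed conjugate polynomial of A. *)
Lemma ip_conv_rev L a b a' b' u v :
  (forall j : 'I_L, a' j = conjc (a (rev_ord j))) ->
  (forall j : 'I_L, b' j = conjc (b (rev_ord j))) -> l2 u -> l2 v ->
  ip (conv u (trunc L a)) (conv v (trunc L b)) =
  ip (conv u (trunc L b')) (conv v (trunc L a')).
Proof.
move=> aE bE lu lv; rewrite !(funext (conv_trunc _ _ L)).
have su i : l2 (shift i u) by exact: l2_shift.
have sv i : l2 (shift i v) by exact: l2_shift.
have expand (x y : nat -> C) : ip (fun n => \sum_(i < L) x i * shift i u n)
    (fun n => \sum_(i < L) y i * shift i v n)
    = \sum_(i < L) \sum_(j < L) x i * conjc (y j) * ip (shift i u) (shift j v).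
  rewrite ip_suml; [|by move=> i; exact: su|by apply: l2_sum => i; exact: sv].
  apply: eq_bigr => i _; rewrite ip_sumr; [|by move=> j; exact: sv|exact: su].
  by rewrite mulr_sumr; apply: eq_bigr => j _; rewrite mulrA.
rewrite !expand [RHS]exchange_big /= (reindex_inj rev_ord_inj) /=.
apply: eq_bigr => i _; rewrite (reindex_inj rev_ord_inj) /=; apply: eq_bigr => j _.
rewrite aE bE conjcK [conjc _ * _]mulrC; congr (_ * _).
by rewrite ip_shift_rev // !rev_ordK.
Qed.

End ConvAlgebra.

(** * Hardy space and its norm through Taylor coefficients *)

Section HardyNorm.
Variable R : realType.
Local Notation C := (R[i]).
Implicit Types (a b : nat -> C) (f h om : disk R -> C).

Lemma H2P f : H2 f <-> exists a, is_taylor a f /\ l2 a.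
Proof.
split=> -[a [ta]].
  move=> [l cl]; exists a; split => //.
  exists (limn (fun N : nat => \sum_(n < N) sqn (a n))) => N.
  apply: (@nondecreasing_cvgn_le R (fun N : nat => \sum_(n < N) sqn (a n))).
    by move=> n m nm; exact: psqn_mono.
  by apply/cvg_ex; exists l.
move=> [B hB]; exists a; split => //.
exists (limn (fun N : nat => \sum_(n < N) sqn (a n))).
apply: nondecreasing_is_cvgn; first by move=> n m nm; exact: psqn_mono.
by exists B => _ [n _ <-].
Qed.

Lemma H2_l2 a f : is_taylor a f -> H2 f -> l2 a.
Proof. by move=> ta /H2P[b [tb lb]]; rewrite (taylor_uniq ta tb). Qed.

Lemma h2normE a f : is_taylor a f -> l2 a -> h2norm f = nrm a.
Proof.
move=> ta la; rewrite /h2norm /nrm; congr Num.sqrt.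
rewrite (_ : ereal_sup _ = (nrm2 a)%:E) //; apply/eqP; rewrite eq_le; apply/andP; split.
  apply: ge_ereal_sup => _ [b [N [tb ->]]].
  by rewrite lee_fin (taylor_uniq tb ta); exact: nrm2_partial.
apply/lee_addgt0Pr => e e0; have [N hN] := nrm2_approx la e0.
apply: (@le_trans _ _ ((\sum_(n < N) sqn (a n)) + e)%:E).
  by rewrite lee_fin; lra.
by rewrite EFinD leeD2r //; apply: ereal_sup_ubound; exists a, N.
Qed.

Lemma Kmod_H2 om f : Kmod om f -> H2 f. Proof. by case. Qed.

Lemma H2_lin (c : C) f h : H2 f -> H2 h -> H2 (fun z => c * f z + h z).
Proof.
move=> /H2P[a [ta la]] /H2P[b [tb lb]]; apply/H2P; exists (lin c a b); split.
  exact: taylor_lin.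
exact: l2_lin.
Qed.

Lemma Kmod_lin om (c : C) f h : Kmod om f -> Kmod om h ->
  Kmod om (fun z => c * f z + h z).
Proof.
move=> [Hf of_] [Hh oh]; split; first exact: H2_lin.
move=> k Hk; have [a [b [ta [tb /cseries_toP ab]]]] := of_ k Hk.
have [a' [b' [ta' [tb' /cseries_toP ab']]]] := oh k Hk.
rewrite (taylor_uniq tb' tb) in ab'.
exists (lin c a a'), b; split; first exact: taylor_lin.
split => //; apply/cseries_toP.
have := ccvgD (ccvgZ c ab) ab'; rewrite mulr0 addr0; apply: ccvg_ext => N.
rewrite /psum mulr_sumr -big_split /=; apply: eq_bigr => i _.
by rewrite /lin; ring.
Qed.

End HardyNorm.

(** * The polynomial pair of a Clark transform, its reversal, and density *)

Section ClarkPairs.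
Variables (R : realType) (mu : {measure set R -> \bar R}).
Hypothesis mu1 : mu setT = 1%E.
Hypothesis muT : mu (~` @Tpar R)%classic = 0%E.
Variable N0 : set R.
Hypothesis mN : measurable N0.
Hypothesis lN : (@lebesgue_measure R) N0 = 0%E.
Hypothesis muN : mu (~` N0)%classic = 0%E.
Local Notation C := (R[i]).
Local Notation CE := (Cint mu).
Local Notation Z := (@expi R).
Local Notation th := (thc mu1).
Local Notation e := (ecoef mu1).
Local Notation mom := (mom mu).
Local Notation conv_l2 := (conv_th_l2 mu1 muT mN lN muN).
Local Notation conv_ip := (conv_th_ip mu1 muT mN lN muN).
Local Notation conv_nrm := (conv_th_nrm mu1 muT mN lN muN).
Implicit Types (q : nat -> C).

Definition tpoly (n L : nat) q (t : R) : C :=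
  conjc (Z t) ^+ n * \sum_(k < L) q k * Z t ^+ k.

(** [z^n] times the Cauchy transform of [tpoly n L q] equals [H q + B] with [H = 1 / (1 - theta)]:
    [B] adds the terms with [j < k], missing from the product [H q], and removes everything below
    [n], where the left side has no coefficients. Multiplication by [1 - theta] leaves [A - theta B]
    with [A = q + B] ([Jseq_shift]). *)
Definition Bseq (n L : nat) q (j : nat) : C :=
  \sum_(k < L) q k * mom k j * ((j < k)%N%:R - (j < n)%N%:R).
Definition Aseq (n L : nat) q (j : nat) : C := trunc L q j + Bseq n L q j.

Lemma cbm_tpoly n L q : cbm (tpoly n L q).
Proof.
apply: cbmM; first by apply: cbmX; exact: (cbmJ (@cbm_expi R)).
by apply: cbm_sum => k; apply: cbmZ; apply: cbmX; exact: cbm_expi.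
Qed.

Definition Jseq n L q : nat -> C :=
  conv e (fun j => CE (fun t => tpoly n L q t * conjc (Z t) ^+ j)).

Lemma Jseq_taylor n L q : is_taylor (Jseq n L q) (clarkJinv mu (tpoly n L q)).
Proof. by apply: Jinv_taylor; exact: cbm_tpoly. Qed.

Lemma Bseq_trunc n L q : (n <= L)%N -> trunc L (Bseq n L q) = Bseq n L q.
Proof.
move=> nL; apply/funext => j; rewrite /trunc; case: ltnP => // Lj.
rewrite /Bseq big1 // => k _.
have -> : (j < k)%N = false by have := ltn_ord k; lia.
have -> : (j < n)%N = false by lia.
by rewrite subrr mulr0.
Qed.

Lemma Aseq_trunc n L q : (n <= L)%N -> trunc L (Aseq n L q) = Aseq n L q.
Proof.
move=> nL; apply/funext => j; rewrite /Aseq -(Bseq_trunc q nL) /trunc.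
by case: ltnP => //; rewrite addr0.
Qed.

Lemma conv_e b : conv e b = fun n => b n - conv th b n.
Proof.
apply/funext => n; have <- : conv (delta R 0) b n = b n.
  by rewrite conv_delta /shift ltn0 subn0.
rewrite /conv -sumrB; apply: eq_bigr => i _.
by rewrite ecoefE mulrBl.
Qed.

Lemma mom_diag j : mom j j = 1.
Proof. by rewrite -{1 2}(addn0 j) momD mom00. Qed.

Lemma momk_le k j : (k <= j)%N -> mom k j = mom 0 (j - k).
Proof. exact: mom_le. Qed.

Lemma Jseq_shift n L q : (n <= L)%N ->
  shift n (Jseq n L q) = fun j => Aseq n L q j - conv th (Bseq n L q) j.
Proof.
move=> nL; rewrite /Jseq -conv_shift.
have -> : shift n (fun j => CE (fun t => tpoly n L q t * conjc (Z t) ^+ j)) =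
    fun j => conv (mom 0) (trunc L q) j + Bseq n L q j.
  apply/funext => j; rewrite conv_trunc /Bseq -big_split /=.
  have mE (k : 'I_L) : q k * shift k (mom 0) j = q k * mom k j * (k <= j)%N%:R.
    rewrite /shift; case: ltnP => [_|kj]; first by rewrite !mulr0.
    by rewrite mulr1 (momk_le kj).
  have jk (k : 'I_L) : ((k <= j)%N%:R + (j < k)%N%:R : C) = 1.
    by case: ltnP => _; rewrite ?add0r ?addr0.
  rewrite /shift; case: ltnP => [jn|nj].
    rewrite big1 // => k _; rewrite mE -mulrDr addrA jk /= subrr mulr0 //.
  transitivity (CE (fun t => \sum_(k < L) q k * (Z t ^+ k * conjc (Z t) ^+ j))).
    congr CE; apply/funext => t; rewrite /tpoly mulrAC -exprD subnKC // mulr_sumr.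
    by apply: eq_bigr => k _; ring.
  rewrite (CE_sum mu1) => [|k]; last exact: cbm_mono.
  by apply: eq_bigr => k _; rewrite mE -mulrDr addrA jk /= subr0 mulr1.
rewrite convDr convA (funext (ecoefP mu1)) (conv_e (Bseq n L q)).
apply/funext => j; rewrite conv_delta /shift ltn0 subn0 addrA //.
Qed.

Lemma l2_Aseq n L q : (n <= L)%N -> l2 (Aseq n L q).
Proof. by move=> nL; rewrite -(Aseq_trunc q nL); exact: l2_trunc. Qed.
Lemma l2_Bseq n L q : (n <= L)%N -> l2 (Bseq n L q).
Proof. by move=> nL; rewrite -(Bseq_trunc q nL); exact: l2_trunc. Qed.

Lemma l2_Jseq n L q : (n <= L)%N -> l2 (Jseq n L q).
Proof.
move=> nL; apply: (@l2_unshift _ n); rewrite Jseq_shift //.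
by apply: l2B; [exact: l2_Aseq|apply: conv_l2; exact: l2_Bseq].
Qed.

(** The diagonal term of [q] turns the strict inequality of [Bseq] into a weak one. In this form [A]
    and [B] are mirror images of each other under reversal of indices. *)
Lemma AseqE n L q i : (i < L)%N ->
  Aseq n L q i = \sum_(k < L) q k * mom k i * ((i <= k)%N%:R - (i < n)%N%:R).
Proof.
move=> iL; rewrite /Aseq /trunc iL /Bseq (bigD1 (Ordinal iL)) //=.
rewrite [RHS](bigD1 (Ordinal iL)) //= ltnn leqnn addrA; congr (_ + _).
  by rewrite mom_diag !mulr1 sub0r mulrBr mulr1 mulrN.
apply: eq_bigr => k ki; congr (_ * (_ %:R - _)).
by rewrite ltn_neqAle (_ : (i != k)%N) // eq_sym.
Qed.

(** From index [n] on, [B] consists of the coefficients of [conj theta * A] on the circle. The inner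
    sum is the conjugate of a coefficient of [theta H = H - 1]; subtracting 1 removes the diagonal,
    which turns [j <= k] into [j < k]. *)
Lemma th_adjoint n L q j : (n <= j)%N -> (j < L)%N ->
  \sum_(i < L) Aseq n L q i * conjc (shift j th i) = Bseq n L q j.
Proof.
move=> nj jL.
transitivity (\sum_(k < L) q k * \sum_(i < L) mom k i * (i <= k)%N%:R * conjc (shift j th i)).
  under eq_bigr => i _ do rewrite AseqE // mulr_suml.
  rewrite exchange_big /=; apply: eq_bigr => k _; rewrite mulr_sumr.
  apply: eq_bigr => i _; rewrite /shift; case: (ltnP i j) => [_|ji].
    by rewrite conjc0 !mulr0.
  have -> : (i < n)%N = false by lia.
  by rewrite subr0 !mulrA.
apply: eq_bigr => k _; rewrite -mulrA; congr (_ * _).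
transitivity (conjc (conv (shift j th) (mom 0) k)).
  rewrite /conv (big_ord_widen L (fun i => shift j th i * mom 0 (k - i)%N)) //.
  rewrite [in RHS]big_mkcond /= conjc_sum; apply: eq_bigr => i _; rewrite ltnS.
  case: (leqP i k) => ik; last by rewrite mulr0 mul0r conjc0.
  by rewrite conjcM mulr1 mulrC -(momk_le ik) momJ.
have -> : (j < n)%N = false by lia.
rewrite convCf conv_shift convCf /shift subr0; case: (ltnP k j) => [kj|jk].
  have -> : (j < k)%N = false by lia.
  by rewrite conjc0 mulr0.
rewrite conv_thc_mom conjcB -(momk_le jk) momJ // /delta subn_eq0 ltn_neqAle jk andbT.
have [kj|kj] := leqP k j.
  have -> : nat_of_ord k = j by apply/eqP; rewrite eqn_leq kj.
  by rewrite eqxx conjc1 mulr0 mom_diag subrr.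
by rewrite (ltn_eqF kj) conjc0 subr0 mulr1.
Qed.

(** After multiplication by [z^n] the claim reads [<A, theta w> = <theta B, theta w>] with
    [w = z^n v]. The right side is [<B, w>] by isometry, and [w] vanishes below [n], exactly the
    range not covered by [th_adjoint]. *)
Lemma Jseq_orth n L q v : (n <= L)%N -> l2 v -> ip (Jseq n L q) (conv th v) = 0.
Proof.
move=> nL lv; have lJ := l2_Jseq q nL; have lcv := conv_l2 lv.
have lB := l2_Bseq q nL; have lA := l2_Aseq q nL; have lsv := l2_shift n lv.
rewrite -(ip_shift n lJ lcv) -conv_shift Jseq_shift //.
set w := shift n v.
have -> : (fun j => Aseq n L q j - conv th (Bseq n L q) j) =
    lin (-1) (conv th (Bseq n L q)) (Aseq n L q).
  by apply/funext => j; rewrite /lin mulN1r addrC.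
rewrite ip_linl //; try exact: conv_l2.
rewrite conv_ip // -(Bseq_trunc q nL) -(Aseq_trunc q nL) !ip_truncl mulN1r addrC.
apply/eqP; rewrite subr_eq0; apply/eqP.
transitivity (\sum_(j < L) (\sum_(i < L) Aseq n L q i * conjc (shift j th i)) * conjc (w j)).
  rewrite [RHS](_ : _ = \sum_(j < L) \sum_(i < L) Aseq n L q i * conjc (shift j th i) * conjc (w j)).
    rewrite exchange_big /=; apply: eq_bigr => i _.
    rewrite (conv_shift_sum _ _ (ltn_ord i)) conjc_sum mulr_sumr.
    by apply: eq_bigr => j _; rewrite conjcM; ring.
  by apply: eq_bigr => j _; rewrite mulr_suml.
apply: eq_bigr => j _; have [jn|nj] := ltnP j n.
  by rewrite /w /shift jn conjc0 !mulr0.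
by rewrite th_adjoint.
Qed.

Lemma Jinv_Kmod n L q : (n <= L)%N ->
  Kmod (clark_theta mu) (clarkJinv mu (tpoly n L q)).
Proof.
move=> nL; have lJ := l2_Jseq q nL; have tJ := Jseq_taylor n L q.
split; first by apply/H2P; exists (Jseq n L q).
move=> h /H2P[v [tv lv]]; exists (Jseq n L q), (conv th v); split => //.
split; first exact: taylor_mul (thc_taylor mu1) tv.
apply/cseries_toP; rewrite -(Jseq_orth q nL lv).
by apply: ip_cvg => //; exact: conv_l2.
Qed.

(** If [p = tpoly n L q], then [tpoly (L - n) L (qrev L q)] is [conj (Z p)]. *)
Definition qrev (L : nat) q (k : nat) : C := conjc (q (L - k.+1)%N).

Lemma mom_rev L k i : (k < L)%N -> (i < L)%N ->
  mom (L - k.+1) (L - i.+1) = mom i k.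
Proof.
move=> kL iL; rewrite -(momD mu (k + i).+1).
rewrite [X in mom X](_ : _ = (L + i)%N); last by lia.
by rewrite [X in mom _ X](_ : _ = (L + k)%N) ?momD; last by lia.
Qed.

(** Reversal preserves the moments up to conjugation, and the indicators cancel: [[k < i] +
    [i <= k]] and [[n <= i] + [i < n]] are both 1. *)
Lemma Bseq_rev n L q (j : 'I_L) : (n <= L)%N ->
  Bseq (L - n) L (qrev L q) j = - conjc (Aseq n L q (rev_ord j)).
Proof.
move=> nL; apply/eqP; rewrite -addr_eq0; apply/eqP.
rewrite AseqE // conjc_sum {1}/Bseq (reindex_inj rev_ord_inj) /= -big_split /=.
have jL := ltn_ord j; set i := (L - j.+1)%N; have iL : (i < L)%N by rewrite /i; lia.
rewrite big1 // => k _; have kL := ltn_ord k.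
have -> : mom (L - k.+1) j = mom i k.
  by rewrite -(mom_rev kL iL) /i; congr (mom _ _); lia.
rewrite /qrev (_ : (L - (L - k.+1).+1)%N = k); last by lia.
have E1 : conjc (q k * mom k i * ((i <= k)%N%:R - (i < n)%N%:R)) =
    conjc (q k) * mom i k * ((i <= k)%N%:R - (i < n)%N%:R).
  by rewrite !conjcM momJ // conjcB !conjc_nat.
rewrite E1 -mulrDr.
have -> : (j < L - k.+1)%N = (k < i)%N by rewrite /i; lia.
have -> : (j < L - n)%N = (n <= i)%N by rewrite /i; lia.
have -> : ((k < i)%N%:R - (n <= i)%N%:R + ((i <= k)%N%:R - (i < n)%N%:R) : C) = 0.
  by case: (ltnP k i); case: (ltnP i n) => _ _ /=; ring.
by rewrite mulr0.
Qed.

Lemma Aseq_rev n L q (j : 'I_L) : (n <= L)%N ->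
  Aseq (L - n) L (qrev L q) j = - conjc (Bseq n L q (rev_ord j)).
Proof.
move=> nL; rewrite /Aseq Bseq_rev // /Aseq /trunc ltn_ord /qrev ltn_ord /=.
by rewrite conjcD; ring.
Qed.

(** Isometry expresses the squared norm through [||G A||^2], [||G B||^2] and [Re <G A, theta G B>].
    Reversal exchanges the first two by [ip_conv_rev] and fixes the third; the signs of [Aseq_rev]
    and [Bseq_rev] cancel in pairs. Since [A] and [B] are polynomials, [G] need only be
    square-summable. *)
Lemma clark_conj_norm (G : nat -> C) n L q : l2 G -> (n <= L)%N ->
  nrm2 (conv G (Jseq n L q)) = nrm2 (conv G (Jseq (L - n) L (qrev L q))).
Proof.
move=> lG nL.
have key m p : (m <= L)%N ->
    nrm2 (conv G (Jseq m L p)) =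
    nrm2 (conv G (trunc L (Aseq m L p))) + nrm2 (conv G (trunc L (Bseq m L p)))
    - 2 * complex.Re (ip (conv G (trunc L (Aseq m L p)))
                         (conv (conv th G) (trunc L (Bseq m L p)))).
  move=> mL; have lA := l2_conv_trunc L (Aseq m L p) lG.
  have lB := l2_conv_trunc L (Bseq m L p) lG; have lcB := conv_l2 lB.
  have E : shift m (conv G (Jseq m L p)) = lin (-1) (conv th (conv G (trunc L (Bseq m L p))))
      (conv G (trunc L (Aseq m L p))).
    rewrite -conv_shift Jseq_shift // convBr Aseq_trunc // Bseq_trunc //.
    apply/funext => j; rewrite /lin mulN1r addrC; congr (- _ + _).
    by rewrite !convA [conv G th]convCf.
  have lE : l2 (conv G (Jseq m L p)).
    by apply: (@l2_unshift _ m); rewrite E; exact: l2_lin.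
  rewrite -(nrm2_shift m lE) E nrm2_lin // (conv_th_nrm2 mu1 muT mN lN muN) //.
  rewrite -convA (ipC lA lcB) sqnN mulN1r ReN ReJ.
  have -> : sqn (1 : C) = 1 by rewrite -cm_sqr cm1 expr1n.
  by rewrite mul1r mulrN [X in X - _]addrC.
have nL' : (L - n <= L)%N by exact: leq_subr.
have l2tG := conv_l2 lG.
rewrite (key n q nL) (key _ _ nL').
set A := Aseq n L q; set B := Bseq n L q.
set A' := Aseq (L - n) L _; set B' := Bseq (L - n) L _.
pose nA j := - A j; pose nB j := - B j.
have negt (u x : nat -> C) : conv u (trunc L (fun j => - x j)) = fun j => - conv u (trunc L x) j.
  apply/funext => j; rewrite /conv -sumrN; apply: eq_bigr => k _.
  by rewrite /trunc; case: ifP => _; rewrite ?mulr0 ?oppr0 ?mulrN.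
have A'E (j : 'I_L) : A' j = conjc (nB (rev_ord j)).
  by rewrite /A' Aseq_rev // /nB conjcN.
have B'E (j : 'I_L) : B' j = conjc (nA (rev_ord j)).
  by rewrite /B' Bseq_rev // /nA conjcN.
have nrm2N (u : nat -> C) : l2 u -> nrm2 (fun j => - u j) = nrm2 u.
  move=> lu; rewrite -[RHS]mul1r -[1](_ : sqn (-1 : C) = 1).
    by rewrite -nrm2Z //; congr nrm2; apply/funext => j; rewrite mulN1r.
  by rewrite sqnN -cm_sqr cm1 expr1n.
have ipNN (u v : nat -> C) : ip (fun j => - u j) (fun j => - v j) = ip u v.
  congr clim; congr psum; apply/funext => j.
  by rewrite conjcN mulrNN.
have lGA := l2_conv_trunc L A lG; have lGB := l2_conv_trunc L B lG.
have -> : nrm2 (conv G (trunc L A')) = nrm2 (conv G (trunc L B)).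
  by rewrite /nrm2 -(ip_conv_rev A'E A'E lG lG) !negt ipNN.
have -> : nrm2 (conv G (trunc L B')) = nrm2 (conv G (trunc L A)).
  by rewrite /nrm2 -(ip_conv_rev B'E B'E lG lG) !negt ipNN.
by rewrite -(ip_conv_rev B'E A'E lG l2tG) !negt ipNN; ring.
Qed.

(** Here [q] is chosen so that [A] is the truncation of [a], hence [f - J q] has coefficients
    [d + theta B] with [d] the tail of [a]. Both [a] and [J q] are orthogonal to [theta B], which
    forces [||theta B|| <= ||d||]. *)
Lemma clark_dense f (eps : R) : Kmod (clark_theta mu) f -> 0 < eps ->
  exists N q, h2norm (fun z => -1 * clarkJinv mu (tpoly 0 N q) z + f z) < eps.
Proof.
move=> [/H2P[a [ta la]] orth] e0.
have orthj j : ip a (shift j th) = 0.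
  have Hj : H2 (fun z : disk R => val z ^+ j).
    by apply/H2P; exists (delta R j); split; [exact: taylor_delta|exact: l2_delta].
  have [a' [b [ta' [tb /cseries_toP ab]]]] := orth _ Hj.
  rewrite (taylor_uniq ta' ta) in ab; apply: ipE.
  have tb' := taylor_mul (thc_taylor mu1) (@taylor_delta R j).
  by rewrite (taylor_uniq tb tb') convCf (funext (conv_delta j th)) in ab.
have e2 : 0 < eps / 2 by rewrite divr_gt0.
have [N hN] := trunc_approx la e2.
(* The map from [q] to [A] for [n = 0] is triangular Toeplitz with the conjugate moments as entries;
   its inverse has the conjugates of [e] as entries. *)
pose q l := \sum_(i < N) a i * conjc (e (i - l)%N) * (l <= i)%N%:R.
exists N, q.
have AE : Aseq 0 N q = trunc N a.
  rewrite -(Aseq_trunc q (leq0n N)); apply/funext => j; rewrite /trunc; case: ltnP => // jN.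
  rewrite AseqE //.
  transitivity (\sum_(i < N) a i * \sum_(k < N) conjc (e (i - k)%N) * (k <= i)%N%:R * (mom k j * (j <= k)%N%:R)).
    under [RHS]eq_bigr do rewrite mulr_sumr.
    rewrite exchange_big /=; apply: eq_bigr => k _; rewrite /q -mulrA mulr_suml.
    by apply: eq_bigr => i _; rewrite subr0; ring.
  rewrite (bigD1 (Ordinal jN)) //= [X in _ + X]big1 ?addr0.
    rewrite (bigD1 (Ordinal jN)) //= subnn ecoef0 leqnn conjc1 !mul1r mulr1.
    rewrite mom_diag big1 ?addr0 ?mulr1 // => k kj.
    case: (leqP k j) => h1; last by rewrite mulr0 mul0r.
    case: (leqP j k) => h2; last by rewrite !mulr0.
    by case/negP: kj; apply/eqP/val_inj => /=; lia.
  move=> i ij.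
  transitivity (a i * conjc (conv (shift j (mom 0)) e i)).
    congr (_ * _); rewrite /conv conjc_sum (big_ord_widen N (fun k => conjc (shift j (mom 0) k * e (i - k)%N))) //.
    rewrite [RHS]big_mkcond /=; apply: eq_bigr => k _; rewrite ltnS.
    case: (leqP k i) => ki; last by rewrite mulr0 mul0r.
    rewrite mulr1 conjcM mulrC; congr (_ * _); rewrite /shift; case: (ltnP k j) => jk.
      by rewrite mulr0 conjc0.
    by rewrite mulr1 -(momk_le jk) momJ.
  rewrite convCf conv_shift (funext (ecoefP mu1)) /shift /delta.
  case: ltnP => h; first by rewrite conjc0 mulr0.
  rewrite (_ : (i - j == 0)%N = false) ?conjc0 ?mulr0 //.
  apply/negbTE; rewrite subn_eq0 -ltnNge ltn_neqAle h andbT.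
  by apply: contra ij => /eqP hh; apply/eqP/val_inj.
have nL := leq0n N; set B := Bseq 0 N q.
have lB : l2 B by exact: l2_Bseq.
have lcB := conv_l2 lB; have lt := l2_trunc N a.
have JE : Jseq 0 N q = fun j => trunc N a j - conv th B j.
  have := Jseq_shift q nL; rewrite AE => <-; apply/funext => j.
  by rewrite /shift ltn0 subn0.
pose d j := a j - trunc N a j; have ld : l2 d by exact: l2B.
have aB : ip a (conv th B) = 0.
  rewrite /B -(Bseq_trunc q nL) (funext (conv_trunc th _ N)) ip_sumr //.
    by rewrite big1 // => i _; rewrite orthj mulr0.
  by move=> i; apply: l2_shift; exact: thc_l2.
have tB : ip (trunc N a) (conv th B) = ip (conv th B) (conv th B).
  have := Jseq_orth q nL lB; rewrite JE.
  rewrite (_ : (fun j => _) = lin (-1) (conv th B) (trunc N a)).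
    by rewrite ip_linl // mulN1r addrC => /eqP; rewrite subr_eq0 => /eqP.
  by apply/funext => j; rewrite /lin mulN1r addrC.
have dB : nrm2 (conv th B) = - complex.Re (ip d (conv th B)).
  rewrite (_ : d = lin (-1) (trunc N a) a); last first.
    by apply/funext => j; rewrite /lin mulN1r addrC.
  by rewrite ip_linl // aB tB addr0 mulN1r ReN opprK.
have nB : nrm (conv th B) <= nrm d.
  have [->|x0] := eqVneq (nrm (conv th B)) 0; first exact: nrm_ge0.
  have xp : 0 < nrm (conv th B) by rewrite lt0r x0 nrm_ge0.
  rewrite -(ler_pM2r xp) -expr2 nrm_sqr // dB -ReN.
  have l2nd : l2 (fun j => -1 * d j) by exact: l2Z.
  have := CauchySchwarz l2nd lcB; rewrite nrmZ // cmN cm1 mul1r; congr (_ <= _).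
  congr complex.Re; rewrite (_ : (fun j => _) = lin (-1) d (fun=> 0)).
    by rewrite ip_linl ?ip0l ?addr0 ?mulN1r //; exact: l2_0.
  by apply/funext => j; rewrite /lin addr0.
rewrite (h2normE (taylor_lin (-1) (Jseq_taylor 0 N q) ta)); last first.
  by apply: (l2_lin (-1) (l2_Jseq q nL) la).
have -> : (fun j => -1 * Jseq 0 N q j + a j) = fun j => d j + conv th B j.
  by apply/funext => j; rewrite JE /d; ring.
have := nrmD ld lcB; rewrite -/d in hN; lra.
Qed.

End ClarkPairs.

(** * The norm estimate *)

Section OperatorNorms.
Variable R : realType.
Local Notation C := (R[i]).
Implicit Types (f h om : disk R -> C) (A : (disk R -> C) -> (disk R -> C)).

Lemma h2norm_ge0 f : 0 <= h2norm f. Proof. exact: sqrtr_ge0. Qed.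

Lemma h2norm_lin_le (c : C) f h : H2 f -> H2 h ->
  h2norm (fun z => c * f z + h z) <= cm c * h2norm f + h2norm h.
Proof.
move=> /H2P[a [ta la]] /H2P[b [tb lb]].
rewrite (h2normE (taylor_lin c ta tb) (l2_lin c la lb)) (h2normE ta la) (h2normE tb lb).
by rewrite -nrmZ //; apply: nrmD => //; exact: l2Z.
Qed.

Lemma h2normZ (c : C) f : H2 f -> h2norm (fun z => c * f z) = cm c * h2norm f.
Proof.
move=> /H2P[a [ta la]]; rewrite (h2normE ta la) -nrmZ //; apply: h2normE.
  have := taylor_lin c ta (@taylor0 R); congr is_taylor.
    by apply/funext => n; rewrite addr0.
  by apply/funext => z; rewrite addr0.
exact: l2Z.
Qed.

Lemma scale_lin (c : C) f : (fun z => c * f z) = (fun z => (c - 1) * f z + f z).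
Proof. by apply/funext => z; ring. Qed.

Lemma KmodZ om (c : C) f : Kmod om f -> Kmod om (fun z => c * f z).
Proof. by move=> Kf; rewrite scale_lin; exact: Kmod_lin. Qed.

Section Iterates.
Variables (om : disk R -> C) (A : (disk R -> C) -> (disk R -> C)).
Hypothesis bA : bdd_op om A.

Lemma iter_Kmod n f : Kmod om f -> Kmod om (iter n A f).
Proof. by case: bA => kA _ Kf; elim: n => //= n IH; exact: kA. Qed.

Lemma iter_lin n (c : C) f h : Kmod om f -> Kmod om h ->
  iter n A (fun z => c * f z + h z) = (fun z => c * iter n A f z + iter n A h z).
Proof.
move=> Kf Kh; elim: n => //= n ->.
by case: bA => _ [linA _]; apply: linA; exact: iter_Kmod.
Qed.

Lemma iter_bounded n : exists2 B : R, 0 <= B &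
  forall f, Kmod om f -> h2norm (iter n A f) <= B * h2norm f.
Proof.
case: bA => _ [_ [M hM]]; exists (`|M| ^+ n); first exact: exprn_ge0.
move=> f Kf; elim: n => [|n IH]; first by rewrite expr0 mul1r.
rewrite iterS exprS -mulrA (le_trans (hM _ (iter_Kmod n Kf))) //.
apply: (@le_trans _ _ (`|M| * h2norm (iter n A f))); last exact: ler_wpM2l.
by rewrite ler_wpM2r ?h2norm_ge0 // ler_norm.
Qed.

Lemma iterZ n (c : C) f : Kmod om f ->
  iter n A (fun z => c * f z) = (fun z => c * iter n A f z).
Proof. by move=> Kf; rewrite !scale_lin iter_lin. Qed.

Lemma opnorm_le n (c : R) f : (opnorm om (iter n A) <= c%:E)%E -> Kmod om f ->
  h2norm (iter n A f) <= c * h2norm f.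
Proof.
(* Normalization is impossible when [f] has norm zero; there boundedness of the iterate gives the
   claim. *)
move=> oA Kf; have [f0|f0] := eqVneq (h2norm f) 0.
  by have [B _ hB] := iter_bounded n; rewrite f0 mulr0; have := hB f Kf; rewrite f0 mulr0.
have fp : 0 < h2norm f by rewrite lt0r f0 h2norm_ge0.
pose k := Complex (h2norm f)^-1 0.
have ck : cm k = (h2norm f)^-1 by rewrite /k cm_real ger0_norm // invr_ge0 ltW.
have : ((h2norm (iter n A (fun z => k * f z)))%:E <= c%:E)%E.
  apply: le_trans oA; apply: ereal_sup_ubound; exists (fun z => k * f z) => //=.
  split; first exact: KmodZ.
  by rewrite h2normZ ?ck ?mulVf //; exact: Kmod_H2 Kf.
rewrite lee_fin iterZ // h2normZ ?ck; last exact: Kmod_H2 (iter_Kmod n Kf).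
by rewrite mulrC ler_pdivrMr.
Qed.

End Iterates.
End OperatorNorms.

Theorem theorem5p3 (R : realType) (mu : {measure set R -> \bar R})
    (om g : disk R -> R[i]) (T S : (disk R -> R[i]) -> (disk R -> R[i])) :
  (* mu : positive Borel measure on T (parametrized by [0, 2 pi)), mu(T) = 1,
     singular w.r.t. normalized Lebesgue measure m *)
  mu (~` @Tpar R)%classic = 0%E ->
  mu setT = 1%E ->
  (exists N : set R, measurable N /\ (@lebesgue_measure R) N = 0%E /\
                     mu (~` N)%classic = 0%E) ->
  (* omega inner, g in H^2 *)
  inner om -> H2 g ->
  (* X f = g f is a bounded operator from K_theta to K_omega ... *)
  (forall f, Kmod (clark_theta mu) f -> Kmod om (fun z => g z * f z)) ->
  (exists M : R, forall f, Kmod (clark_theta mu) f ->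
       h2norm (fun z => g z * f z) <= M * h2norm f) ->
  (* ... with dense range *)
  (forall h, Kmod om h -> forall e : R, 0 < e ->
     exists f, Kmod (clark_theta mu) f /\
               h2norm (fun z => g z * f z - h z) < e) ->
  (* T in L(K_omega) invertible, with inverse S in L(K_omega) *)
  bdd_op om T -> bdd_op om S ->
  (forall f, Kmod om f -> S (T f) = f /\ T (S f) = f) ->
  (* X J^{-1} U_mu = T X J^{-1} *)
  (forall gam, L2mu mu gam ->
     (fun z => g z * clarkJinv mu (Umu gam) z) =
     T (fun z => g z * clarkJinv mu gam z)) ->
  (ereal_sup (range (fun n : nat => opnorm om (iter n S)))
     <= (ereal_sup (range (fun n : nat => opnorm om (iter n T)))) ^+ 5)%E.
Proof.
move=> muT mu1 [N0 [mN [lN muN]]] _ Hg XK [M XM] Xd bT bS ST TX.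
suff main CT : CT = ereal_sup (range (fun n : nat => opnorm om (iter n T))) ->
    (ereal_sup (range (fun n : nat => opnorm om (iter n S))) <= CT ^+ 5)%E by exact: main.
move=> CTd.
pose X n L q z := g z * clarkJinv mu (tpoly n L q) z.
have KX n L q : (n <= L)%N -> Kmod om (X n L q).
  by move=> nL; apply: XK; exact: (Jinv_Kmod mu1 muT mN lN muN).
have K0 : Kmod om (fun=> 0).
  have := KmodZ 0 (KX 0%N 0%N (fun=> 0) isT); congr Kmod.
  by apply/funext => z; rewrite mul0r.
have n00 : h2norm (fun=> 0 : R[i]) = 0 :> R.
  by rewrite (h2normE (@taylor0 R) (@l2_0 R)) /nrm /nrm2 ip0l sqrtr0.
have CT0 : (0 <= CT)%E.
  apply: (@le_trans _ _ (opnorm om (iter 0 T))); last first.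
    by rewrite CTd; apply: ereal_sup_ubound; exists 0%N.
  by apply: ereal_sup_ubound; exists (fun=> 0); rewrite /= n00.
(* An infinite supremum makes the right side infinite; otherwise it is a real constant [c]. *)
have [->|] := eqVneq CT +oo%E; first by rewrite !expeS expe0 mule1 !mulyy leey.
move=> CToo; have CTf : CT \is a fin_num by rewrite ge0_fin_numE // lt_neqAle CToo leey.
pose c := fine CT; have CTE : CT = c%:E by rewrite fineK.
have c0 : 0 <= c by rewrite -lee_fin -CTE.
have Tc n f : Kmod om f -> h2norm (iter n T f) <= c * h2norm f.
  by apply: (opnorm_le bT); rewrite -CTE CTd; apply: ereal_sup_ubound; exists n.
(* Boundedness is carried through the induction because the intertwining relation is available only
   for functions in [L2mu]. *)
have TXn n y : cbm y -> iter n T (fun z => g z * clarkJinv mu y z) =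
    (fun z => g z * clarkJinv mu (iter n (@Umu R) y) z) /\ cbm (iter n (@Umu R) y).
  move=> cy; elim: n => // n [/= -> cn]; split.
    rewrite -TX //; split; first by case: cn => -[].
    split; first by case: cn => _ [].
    have /integrableP[_] := bm_integrable mu1 (bm_sqn cn).
    apply: le_lt_trans; apply: ge0_le_integral => //.
    - by move=> t _; rewrite lee_fin sqn_ge0.
    - by apply/measurable_EFinP; exact: (bm_sqn cn).1.
    - by apply: measurableT_comp => //; apply/measurable_EFinP; exact: (bm_sqn cn).1.
    - by move=> t _ /=; rewrite lee_fin ler_norm.
  exact: cbmM (@cbm_expi R) cn.
have UE n y t : iter n (@Umu R) y t = expi t ^+ n * y t.
  elim: n t => [|n IH] t; first by rewrite expr0 mul1r.
  by rewrite iterS /Umu IH exprS mulrA.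
have TXE n k L q : iter n T (X (n + k)%N L q) = X k L q.
  rewrite (TXn n _ (cbm_tpoly (n + k) L q)).1 /X; congr (fun y z => g z * clarkJinv mu y z).
  apply/funext => t; rewrite UE /tpoly exprD mulrA mulrA -exprMn expi_mulJ.
  by rewrite expr1n mul1r.
have STn n f : Kmod om f -> iter n S (iter n T f) = f.
  move=> Kf; elim: n => // n IH; rewrite iterSr /= (ST _ (iter_Kmod bT n Kf)).1.
  exact: IH.
have Xsym n L q : (n <= L)%N -> h2norm (X n L q) = h2norm (X (L - n)%N L (qrev L q)).
  have [G [tG lG]] := (H2P g).1 Hg.
  have nE m p : (m <= L)%N -> h2norm (X m L p) = nrm (conv G (Jseq mu1 m L p)).
    move=> mL; have tX := taylor_mul tG (Jseq_taylor mu1 m L p).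
    by apply: (h2normE tX); exact: (H2_l2 tX (Kmod_H2 (KX m L p mL))).
  move=> nL; rewrite (nE _ _ nL) (nE _ _ (leq_subr n L)).
  by rewrite /nrm (clark_conj_norm mu1 muT mN lN muN q lG nL).
have SX n N q : h2norm (iter n S (X 0%N N q)) <= c * h2norm (X 0%N N q).
  (* Padding [q] with zeros to length [n + N] guarantees [n <= L], without which [A] and [B] would
     not have degree below [L]. Then [S^n X_0 = X_n]; reversal gives index [L - n], [T^n] reaches it
     from index [L], and reversal takes [L] back to 0. *)
  pose L := (n + N)%N; pose q' := trunc N q.
  have -> : X 0%N N q = X 0%N L q'.
    congr (fun y z => g z * clarkJinv mu y z); apply/funext => t.
    rewrite /tpoly /L addnC big_split_ord /= [X in _ + X]big1 ?addr0 => [|k _].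
      by congr (_ * _); apply: eq_bigr => k _; rewrite /q' /trunc ltn_ord.
    by rewrite /q' /trunc ltnNge leq_addr mul0r.
  have nL : (n <= L)%N by exact: leq_addr.
  rewrite -{1}(TXE n 0%N) addn0 STn; last exact: KX.
  rewrite Xsym // [X in _ <= _ * X]Xsym // subn0.
  rewrite -(TXE n (L - n)%N) subnKC //.
  by apply: Tc; exact: KX.
have Sc n f : Kmod om f -> h2norm (iter n S f) <= c * h2norm f.
  move=> Kf; have [B B0 hB] := iter_bounded bS n.
  have Bc : 0 < 2 * (B + c) + 1 by rewrite ltr_wpDl // mulr_ge0 // addr_ge0.
  apply/ler_addgt0Pr => e e0.
  (* Both approximations, of [f] by [g f1] and of [g f1] by [x], cost [d], so [||f - x|| <= 2 d] and
     the total error is at most [2 d (B + c)]. The bound [B] may depend on [n], because [n] is fixed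
     before [d]; the added 1 keeps the divisor positive. *)
  pose d := e / (2 * (B + c) + 1); have d0 : 0 < d by rewrite divr_gt0.
  have [f1 [Kf1 hf1]] := Xd f Kf d d0.
  have M1 : 0 < `|M| + 1 by rewrite ltr_wpDl.
  have [N [q hq]] := clark_dense mu1 muT mN lN muN Kf1 (divr_gt0 d0 M1).
  have KJ := Jinv_Kmod mu1 muT mN lN muN q (leq0n N).
  pose x := X 0%N N q; have Kx : Kmod om x by exact: KX.
  pose u z := -1 * clarkJinv mu (tpoly 0 N q) z + f1 z.
  have Ku : Kmod (clark_theta mu) u by exact: Kmod_lin.
  have gu : h2norm (fun z => g z * u z) <= d.
    rewrite (le_trans (XM u Ku)) //.
    apply: (@le_trans _ _ ((`|M| + 1) * h2norm u)).
      by rewrite ler_wpM2r ?h2norm_ge0 // (le_trans (ler_norm M)) // lerDl.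
    by rewrite mulrC -ler_pdivlMr // ltW.
  have Kv : Kmod om (fun z => g z * f1 z - f z).
    have := Kmod_lin (-1) Kf (XK _ Kf1); congr Kmod.
    by apply/funext => z; rewrite mulN1r addrC.
  pose w z := -1 * x z + f z; have Kw : Kmod om w by exact: Kmod_lin.
  have hw : h2norm w <= 2 * d.
    have -> : w = fun z => -1 * (g z * f1 z - f z) + g z * u z.
      by apply/funext => z; rewrite /w /x /X /u; ring.
    rewrite (le_trans (h2norm_lin_le _ (Kmod_H2 Kv) (Kmod_H2 (XK _ Ku)))) //.
    by rewrite cmN cm1 mul1r mulr_natl mulr2n; exact: lerD (ltW hf1) gu.
  have fE : f = fun z => 1 * w z + x z by apply/funext => z; rewrite /w; ring.
  have xE : x = fun z => -1 * w z + f z by apply/funext => z; rewrite /w; ring.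
  have hx : h2norm x <= 2 * d + h2norm f.
    rewrite {1}xE (le_trans (h2norm_lin_le _ (Kmod_H2 Kw) (Kmod_H2 Kf))) //.
    by rewrite cmN cm1 mul1r lerD2r.
  have := h2norm_lin_le 1 (Kmod_H2 (iter_Kmod bS n Kw)) (Kmod_H2 (iter_Kmod bS n Kx)).
  rewrite -(iter_lin bS n 1 Kw Kx) -fE cm1 mul1r.
  have := le_trans (hB w Kw) (ler_wpM2l B0 hw).
  have := le_trans (SX n N q) (ler_wpM2l c0 hx); rewrite -/x.
  have : d * (2 * (B + c) + 1) = e by rewrite /d divfK // gt_eqF.
  move: (h2norm f) (h2norm (iter n S f)) (h2norm (iter n S w)) (h2norm (iter n S x)).
  by clear -d0 => nf s1 s2 s3; lra.
rewrite CTE -EFin_expe.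
apply: ge_ereal_sup => _ [n _ <-]; apply: ge_ereal_sup => _ [f [Kf f1] <-].
rewrite lee_fin.
have [c1|c1] := leP 1 c.
  rewrite (le_trans (Sc n f Kf)) // (@le_trans _ _ c) //.
    by rewrite -[leRHS]mulr1 ler_wpM2l.
  by rewrite -[leLHS]expr1 ler_weXn2l.
(* If c < 1 then the bound for n = 0 forces K_om = 0. *)
have := Tc 0%N _ (iter_Kmod bS n Kf); have := h2norm_ge0 (iter n S f); rewrite /=.
move: (h2norm (iter n S f)) => y y0 yc.
have -> : y = 0 by clear -c0 c1 y0 yc; apply/eqP; rewrite eq_le y0 andbT; nra.
exact: exprn_ge0.
Qed.
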